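(* Let $n\ge2$ and $1\le\ell\le\lfloor n/2\rfloor$, and let $$\gamma_\ell=\ell\alpha_0+\sum_{i=1}^{\ell-1}(\ell-i)(\alpha_i+\alpha_{n-i}).$$ The multiplicity of the maximal dominant weight $2\Lambda_0-\gamma_\ell$ in the $\widehat{sl}(n)$-module $V(2\Lambda_0)$ equals the number of $321$-avoiding permutations of $\{1,2,\dots,\ell\}$.
   Context: $\widehat{sl}(n)$ is the affine Kac-Moody algebra of type $A^{(1)}_{n-1}$, with simple roots $\alpha_0,\dots,\alpha_{n-1}$ and fundamental weights $\Lambda_i$; $V(\Lambda)$ is the integrable highest weight module with highest weight $\Lambda$. A weight $\mu$ of $V(\Lambda)$ is maximal if $\mu+\delta$ is not a weight, where $\delta=\alpha_0+\dots+\alpha_{n-1}$. The multiplicity of a weight is the dimension of its weight space. A permutation $w=w_1w_2\cdots w_\ell$ of $\{1,\dots,\ell\}$ is $321$-avoiding if it has no decreasing subsequence of length three. *)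

(* Defs.v *)
From HB Require Import structures.
From mathcomp Require Import all_boot all_order all_algebra all_fingroup.
From mathcomp Require Import generic_quotient.
From mathcomp Require Import boolp classical_sets reals.
From mathcomp Require Import complex.

Set Implicit Arguments.
Unset Strict Implicit.
Unset Printing Implicit Defensive.

Import GRing.Theory.
Local Open Scope ring_scope.
Local Open Scope quotient_scope.

HB.mixin Record Lmodule_isLie (K : fieldType) g of GRing.Lmodule K g := {
  lie_br : g -> g -> g;
  lie_br_linl : forall (a : K) (x y z : g),
    lie_br (a *: x + y) z = a *: lie_br x z + lie_br y z;
  lie_br_linr : forall (a : K) (x y z : g),
    lie_br x (a *: y + z) = a *: lie_br x y + lie_br x z;
  lie_brxx : forall x : g, lie_br x x = 0;
  lie_jacobi : forall x y z : g,
    lie_br x (lie_br y z) + lie_br y (lie_br z x) + lie_br z (lie_br x y) = 0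
}.

#[short(type="lieAlgType")]
HB.structure Definition LieAlgebra (K : fieldType) :=
  { g of GRing.Lmodule K g & Lmodule_isLie K g }.

Record lieRep (K : fieldType) (g : lieAlgType K) (V : lmodType K) := LieRep {
  rep_act :> g -> V -> V;
  rep_linl : forall (a : K) (x y : g) (v : V),
    rep_act (a *: x + y) v = a *: rep_act x v + rep_act y v;
  rep_linr : forall (a : K) (x : g) (v w : V),
    rep_act x (a *: v + w) = a *: rep_act x v + rep_act x w;
  rep_br : forall (x y : g) (v : V),
    rep_act (lie_br x y) v = rep_act x (rep_act y v) - rep_act y (rep_act x v)
}.

(* [lie_pres rel], below, is the Lie algebra generated by [X] subject to the
   relations [s = t] for [rel s t]: the set of all formal Lie expressions in
   the generators modulo the congruence generated by [rel] and by the axioms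
   of a Lie algebra over [K]. *)

Inductive lie_term (K : fieldType) (X : Type) : Type :=
| LGen of X
| LZero
| LAdd of lie_term K X & lie_term K X
| LScale of K & lie_term K X
| LBr of lie_term K X & lie_term K X.

Arguments LGen {K X}.
Arguments LZero {K X}.

Inductive lie_eq (K : fieldType) (X : Type)
    (rel : lie_term K X -> lie_term K X -> Prop) :
    lie_term K X -> lie_term K X -> Prop :=
| LErel s t : rel s t -> lie_eq rel s t
| LErefl s : lie_eq rel s s
| LEsym s t : lie_eq rel s t -> lie_eq rel t s
| LEtrans s t u : lie_eq rel s t -> lie_eq rel t u -> lie_eq rel s u
| LEadd s s' t t' :
    lie_eq rel s s' -> lie_eq rel t t' -> lie_eq rel (LAdd s t) (LAdd s' t')
| LEscale a s s' : lie_eq rel s s' -> lie_eq rel (LScale a s) (LScale a s')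
| LEbr s s' t t' :
    lie_eq rel s s' -> lie_eq rel t t' -> lie_eq rel (LBr s t) (LBr s' t')
| LEaddA s t u : lie_eq rel (LAdd s (LAdd t u)) (LAdd (LAdd s t) u)
| LEaddC s t : lie_eq rel (LAdd s t) (LAdd t s)
| LEadd0 s : lie_eq rel (LAdd LZero s) s
| LEaddN s : lie_eq rel (LAdd (LScale (-1) s) s) LZero
| LEscaleA a b s : lie_eq rel (LScale a (LScale b s)) (LScale (a * b) s)
| LEscale1 s : lie_eq rel (LScale 1 s) s
| LEscaleDr a s t :
    lie_eq rel (LScale a (LAdd s t)) (LAdd (LScale a s) (LScale a t))
| LEscaleDl a b s :
    lie_eq rel (LScale (a + b) s) (LAdd (LScale a s) (LScale b s))
| LEbrl a s t u :
    lie_eq rel (LBr (LAdd (LScale a s) t) u)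
               (LAdd (LScale a (LBr s u)) (LBr t u))
| LEbrr a s t u :
    lie_eq rel (LBr s (LAdd (LScale a t) u))
               (LAdd (LScale a (LBr s t)) (LBr s u))
| LEbrxx s : lie_eq rel (LBr s s) LZero
| LEjacobi s t u :
    lie_eq rel (LAdd (LAdd (LBr s (LBr t u)) (LBr t (LBr u s)))
                     (LBr u (LBr s t))) LZero.

HB.instance Definition _ (K : fieldType) (X : Type) :=
  gen_eqMixin (lie_term K X).
HB.instance Definition _ (K : fieldType) (X : Type) :=
  gen_choiceMixin (lie_term K X).

Section LiePresentation.
Variables (K : fieldType) (X : Type).
Variable rel : lie_term K X -> lie_term K X -> Prop.

Definition lie_eqb (s t : lie_term K X) : bool := `[< lie_eq rel s t >].

Lemma lie_eqb_refl : reflexive lie_eqb.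
Proof. by move=> s; apply/asboolP; exact: LErefl. Qed.

Lemma lie_eqb_sym : symmetric lie_eqb.
Proof. by move=> s t; apply/asboolP/asboolP; exact: LEsym. Qed.

Lemma lie_eqb_trans : transitive lie_eqb.
Proof.
by move=> t s u /asboolP st /asboolP tu; apply/asboolP; exact: LEtrans tu.
Qed.

Canonical lie_eqb_equiv :=
  EquivRel lie_eqb lie_eqb_refl lie_eqb_sym lie_eqb_trans.

Definition lie_pres : Type := {eq_quot lie_eqb_equiv}.
HB.instance Definition _ := Choice.on lie_pres.

Definition lie_class (s : lie_term K X) : lie_pres :=
  \pi_{eq_quot lie_eqb_equiv} s.
Definition lie_repr (x : lie_pres) : lie_term K X :=
  repr (x : {eq_quot lie_eqb_equiv}).

Lemma lie_classP s t : lie_class s = lie_class t <-> lie_eq rel s t.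
Proof.
split=> [/eqP|st]; first by rewrite /lie_class eqmodE => /asboolP.
by apply/eqP; rewrite /lie_class eqmodE; apply/asboolP.
Qed.

Lemma lie_reprK x : lie_class (lie_repr x) = x.
Proof. exact: reprK. Qed.

Lemma lie_reprP s : lie_eq rel (lie_repr (lie_class s)) s.
Proof. by apply/lie_classP; exact: lie_reprK. Qed.

Lemma lie_pres_ind (P : lie_pres -> Prop) :
  (forall s, P (lie_class s)) -> forall x, P x.
Proof. by move=> Pc x; rewrite -(lie_reprK x). Qed.

Definition lp_add (x y : lie_pres) := lie_class (LAdd (lie_repr x) (lie_repr y)).
Definition lp_scale (a : K) (x : lie_pres) := lie_class (LScale a (lie_repr x)).
Definition lp_opp (x : lie_pres) := lp_scale (-1) x.
Definition lp_br (x y : lie_pres) := lie_class (LBr (lie_repr x) (lie_repr y)).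

Lemma lp_addE s t : lp_add (lie_class s) (lie_class t) = lie_class (LAdd s t).
Proof. by apply/lie_classP; apply: LEadd; exact: lie_reprP. Qed.

Lemma lp_scaleE a s : lp_scale a (lie_class s) = lie_class (LScale a s).
Proof. by apply/lie_classP; apply: LEscale; exact: lie_reprP. Qed.

Lemma lp_brE s t : lp_br (lie_class s) (lie_class t) = lie_class (LBr s t).
Proof. by apply/lie_classP; apply: LEbr; exact: lie_reprP. Qed.

Definition lpE := (lp_addE, lp_scaleE, lp_brE).

Fact lp_addA : associative lp_add.
Proof.
elim/lie_pres_ind=> s; elim/lie_pres_ind=> t; elim/lie_pres_ind=> u.
by rewrite !lpE; apply/lie_classP; exact: LEaddA.
Qed.

Fact lp_addC : commutative lp_add.
Proof.
elim/lie_pres_ind=> s; elim/lie_pres_ind=> t.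
by rewrite !lpE; apply/lie_classP; exact: LEaddC.
Qed.

Fact lp_add0 : left_id (lie_class LZero) lp_add.
Proof.
by elim/lie_pres_ind=> s; rewrite !lpE; apply/lie_classP; exact: LEadd0.
Qed.

Fact lp_addN : left_inverse (lie_class LZero) lp_opp lp_add.
Proof.
elim/lie_pres_ind=> s.
by rewrite /lp_opp !lpE; apply/lie_classP; exact: LEaddN.
Qed.

HB.instance Definition _ :=
  GRing.isZmodule.Build lie_pres lp_addA lp_addC lp_add0 lp_addN.

Lemma lie_classD s t : lie_class s + lie_class t = lie_class (LAdd s t).
Proof. exact: lp_addE. Qed.

Fact lp_scaleA a b (x : lie_pres) :
  lp_scale a (lp_scale b x) = lp_scale (a * b) x.
Proof.
by elim/lie_pres_ind: x => s; rewrite !lpE; apply/lie_classP; exact: LEscaleA.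
Qed.

Fact lp_scale1 : left_id 1 lp_scale.
Proof.
by elim/lie_pres_ind=> s; rewrite !lpE; apply/lie_classP; exact: LEscale1.
Qed.

Fact lp_scaleDr : right_distributive lp_scale +%R.
Proof.
move=> a; elim/lie_pres_ind=> s; elim/lie_pres_ind=> t.
by rewrite !(lpE, lie_classD); apply/lie_classP; exact: LEscaleDr.
Qed.

Fact lp_scaleDl (x : lie_pres) : {morph lp_scale^~ x : a b / a + b}.
Proof.
move=> a b; elim/lie_pres_ind: x => s.
by rewrite !(lpE, lie_classD); apply/lie_classP; exact: LEscaleDl.
Qed.

HB.instance Definition _ := GRing.Zmodule_isLmodule.Build K lie_pres
  lp_scaleA lp_scale1 lp_scaleDr lp_scaleDl.

Lemma lie_classZ a s : a *: lie_class s = lie_class (LScale a s).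
Proof. exact: lp_scaleE. Qed.

Fact lp_br_linl (a : K) (x y z : lie_pres) :
  lp_br (a *: x + y) z = a *: lp_br x z + lp_br y z.
Proof.
elim/lie_pres_ind: x => s; elim/lie_pres_ind: y => t.
elim/lie_pres_ind: z => u.
by rewrite lie_classZ lie_classD !lp_brE lie_classZ lie_classD;
  apply/lie_classP; exact: LEbrl.
Qed.

Fact lp_br_linr (a : K) (x y z : lie_pres) :
  lp_br x (a *: y + z) = a *: lp_br x y + lp_br x z.
Proof.
elim/lie_pres_ind: x => s; elim/lie_pres_ind: y => t.
elim/lie_pres_ind: z => u.
by rewrite lie_classZ lie_classD !lp_brE lie_classZ lie_classD;
  apply/lie_classP; exact: LEbrr.
Qed.

Fact lp_brxx (x : lie_pres) : lp_br x x = 0.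
Proof.
by elim/lie_pres_ind: x => s; rewrite !lpE; apply/lie_classP; exact: LEbrxx.
Qed.

Fact lp_jacobi (x y z : lie_pres) :
  lp_br x (lp_br y z) + lp_br y (lp_br z x) + lp_br z (lp_br x y) = 0.
Proof.
elim/lie_pres_ind: x => s; elim/lie_pres_ind: y => t.
elim/lie_pres_ind: z => u.
by rewrite !lp_brE !lie_classD; apply/lie_classP; exact: LEjacobi.
Qed.

HB.instance Definition _ := Lmodule_isLie.Build K lie_pres
  lp_br_linl lp_br_linr lp_brxx lp_jacobi.

Lemma lie_class_br s t :
  lie_br (lie_class s) (lie_class t) = lie_class (LBr s t).
Proof. exact: lp_brE. Qed.

End LiePresentation.

(* The Cartan matrix of type A^(1)_{n-1} for n >= 2.  The nodes are 0, ..., n-1.  The formula gives the cyclic Dynkin diagram for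
   n >= 3 and, the two neighbours of a node being equal, off-diagonal entries
   -2 for n = 2. *)
Definition cartan (n i j : nat) : int :=
  2 * (i == j)%:Z - (i == j.+1 %[mod n])%:Z - (j == i.+1 %[mod n])%:Z.

(* The Cartan subalgebra has the basis alpha_0^v, ..., alpha_{n-1}^v, d, and
   its elements are column vectors of coordinates in that basis.  A weight is
   the row vector of its values on that basis: coordinate k < n is the value on
   alpha_k^v, coordinate n the value on d. *)
Definition cartan_alg (K : fieldType) (n : nat) := 'cV[K]_n.+1.
Definition weight (K : fieldType) (n : nat) := 'rV[K]_n.+1.

Section CartanDatum.
Variables (K : fieldType) (n : nat).

Definition wt_val (lam : weight K n) (h : cartan_alg K n) : K :=
  (lam *m h) 0 0.

Definition coroot (i : nat) : cartan_alg K n := \col_(k < n.+1) (k == i :> nat)%:R.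

Definition simple_root (j : nat) : weight K n :=
  \row_(k < n.+1) if (k < n)%N then (cartan n k j)%:~R else (j == 0%N)%:R.

Definition fund_weight (i : nat) : weight K n :=
  \row_(k < n.+1) (k == i :> nat)%:R.

Definition null_root : weight K n := \sum_(0 <= j < n) simple_root j.

Definition dominant (lam : weight K n) : Prop :=
  forall i : 'I_n, exists m : nat, wt_val lam (coroot i) = m%:R.

End CartanDatum.

(* The affine Kac-Moody algebra of type A^(1)_{n-1} is given by its
   Chevalley-Serre presentation, with the full Cartan subalgebra (including
   the degree derivation d) among the generators.  The Cartan matrix being
   symmetrizable, this agrees with Kac's definition (Gabber-Kac). *)
Inductive km_gen (K : fieldType) (n : nat) : Type :=
| GenE of 'I_n
| GenF of 'I_n
| GenH of cartan_alg K n.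

Arguments GenE {K n}.
Arguments GenF {K n}.
Arguments GenH {K n}.

Section KacMoody.
Variables (K : fieldType) (n : nat).

Local Notation term := (lie_term K (km_gen K n)).
Local Notation E i := (LGen (GenE i) : term).
Local Notation F i := (LGen (GenF i) : term).
Local Notation H h := (LGen (GenH h) : term).
Local Notation a_ i j := (cartan n i j).
Local Notation alpha i := (simple_root K n i).

Inductive km_rel : term -> term -> Prop :=
| KM_lin (c : K) (h h' : cartan_alg K n) :
    km_rel (H (c *: h + h')) (LAdd (LScale c (H h)) (H h'))
| KM_HH (h h' : cartan_alg K n) : km_rel (LBr (H h) (H h')) LZero
| KM_HE (h : cartan_alg K n) (i : 'I_n) :
    km_rel (LBr (H h) (E i)) (LScale (wt_val (alpha i) h) (E i))
| KM_HF (h : cartan_alg K n) (i : 'I_n) :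
    km_rel (LBr (H h) (F i)) (LScale (- wt_val (alpha i) h) (F i))
| KM_EF (i j : 'I_n) :
    km_rel (LBr (E i) (F j)) (if i == j then H (coroot K n i) else LZero)
| KM_serreE (i j : 'I_n) : i != j ->
    km_rel (iter `|1 - a_ i j|%N (LBr (E i)) (E j)) LZero
| KM_serreF (i j : 'I_n) : i != j ->
    km_rel (iter `|1 - a_ i j|%N (LBr (F i)) (F j)) LZero.

Definition affine_sl : lieAlgType K := lie_pres km_rel.

Definition km_e (i : 'I_n) : affine_sl := lie_class km_rel (E i).
Definition km_f (i : 'I_n) : affine_sl := lie_class km_rel (F i).
Definition km_h (h : cartan_alg K n) : affine_sl := lie_class km_rel (H h).

Variables (V : lmodType K) (rho : lieRep affine_sl V).

Definition weight_space (mu : weight K n) : set V :=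
  [set v | forall h, rho (km_h h) v = wt_val mu h *: v].

Definition is_weight (mu : weight K n) : Prop :=
  exists2 v, weight_space mu v & v != 0.

Definition maximal_weight (mu : weight K n) : Prop :=
  is_weight mu /\ ~ is_weight (mu + null_root K n).

Definition has_dim (W : set V) (m : nat) : Prop :=
  exists b : 'I_m -> V,
    [/\ forall i, W (b i),
        forall c : 'I_m -> K,
          \sum_(i < m) c i *: b i = 0 -> forall i, c i = 0
      & forall v, W v -> exists c : 'I_m -> K, v = \sum_(i < m) c i *: b i].

Definition multiplicity (mu : weight K n) (m : nat) : Prop :=
  has_dim (weight_space mu) m.

Definition submodule (W : set V) : Prop :=
  [/\ W 0,
      forall (a : K) v w, W v -> W w -> W (a *: v + w)
    & forall (x : affine_sl) v, W v -> W (rho x v)].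

(* The last condition says that V = U(g) v. *)
Definition highest_weight_module (Lam : weight K n) : Prop :=
  exists v : V,
    [/\ v != 0, weight_space Lam v, forall i, rho (km_e i) v = 0
      & forall W : set V, submodule W -> W v -> W = setT].

(* The sum of the weight spaces is automatically direct. *)
Definition weight_module : Prop :=
  forall v : V, exists (m : nat) (mu : 'I_m -> weight K n) (w : 'I_m -> V),
    (forall i, weight_space (mu i) (w i)) /\ v = \sum_(i < m) w i.

Definition integrable : Prop :=
  weight_module /\
  forall (i : 'I_n) (v : V), exists N : nat,
    iter N (rho (km_e i)) v = 0 /\ iter N (rho (km_f i)) v = 0.

(* For dominant integral Lam this determines the module up to isomorphism: it
   is V(Lam). *)
Definition integrable_hw_module (Lam : weight K n) : Prop :=
  highest_weight_module Lam /\ integrable.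

End KacMoody.

Definition gamma_wt (K : fieldType) (n l : nat) : weight K n :=
  l%:R *: simple_root K n 0
  + \sum_(1 <= i < l)
      (l - i)%N%:R *: (simple_root K n i + simple_root K n (n - i)%N).

Definition avoids321 (l : nat) (w : 'S_l) : bool :=
  ~~ [exists i : 'I_l, exists j : 'I_l, exists k : 'I_l,
        [&& (i < j)%N, (j < k)%N, (w i > w j)%N & (w j > w k)%N]].

(* Main.v *)
Require Import Defs.
From mathcomp Require Import all_boot all_order all_algebra all_fingroup.
From mathcomp Require Import boolp classical_sets reals.
From mathcomp Require Import complex.
From mathcomp Require Import zify ring.

(** The nodes with a nonzero coefficient in gamma_l lie in a string of 2l - 1
    nodes of type A, so the weight space is the zero weight space of an
    sl(2l)-module with highest weight 2 omega_l, whose dimension is the number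
    of standard tableaux of shape (2^l).  As V is given only abstractly, both
    bounds are proved by hand, for an explicit family of words in the f_i
    indexed by ballot sequences.

    Upper bound: a gl(M)-singular vector of weight (0^p, 1^q, 2^p), M = 2p + q,
    is restricted to gl(M - 1).  The words with exactly one f_0 are spanned by
    the gl(M - 1)-words applied to two vectors, singular of weights
    (0^p, 1^(q-1), 2^p) and (0^(p-1), 1^(q+1), 2^(p-1)), the second one only
    modulo the submodule generated by the first.  Hence "singular modulo a
    subspace" is the notion that supports the induction.

    Lower bound: a linear relation between the words in V forces every product
    of raising operators to kill the corresponding vector of the tensor square
    of an exterior power of K^(2l); the Hermitian form there is positive
    definite, so the relation already holds in that model, where the words are
    visibly independent.

    321-avoiding permutations, built by inserting the maximum, obey the same
    recursion. *)

Set Implicit Arguments.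
Unset Strict Implicit.
Unset Printing Implicit Defensive.
Import Order.TTheory GRing.Theory Num.Theory.
Local Open Scope ring_scope.

(** * Type A relations and root vectors *)

Section LieIdentities.
Variables (K : numClosedFieldType) (g : lieAlgType K).
Implicit Types x y z : g.

Lemma br0l x : lie_br 0 x = 0.
Proof. by have := lie_br_linl (-1) x x x; rewrite !scaleN1r !addNr. Qed.

Lemma br0r x : lie_br x 0 = 0.
Proof. by have := lie_br_linr (-1) x x x; rewrite !scaleN1r !addNr. Qed.

Lemma brZl a x y : lie_br (a *: x) y = a *: lie_br x y.
Proof. by rewrite -[a *: x]addr0 lie_br_linl br0l addr0. Qed.

Lemma brZr a x y : lie_br x (a *: y) = a *: lie_br x y.
Proof. by rewrite -[a *: y]addr0 lie_br_linr br0r addr0. Qed.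

Lemma brDl x y z : lie_br (x + y) z = lie_br x z + lie_br y z.
Proof. by rewrite -{1}[x]scale1r lie_br_linl scale1r. Qed.

Lemma brDr x y z : lie_br x (y + z) = lie_br x y + lie_br x z.
Proof. by rewrite -{1}[y]scale1r lie_br_linr scale1r. Qed.

Lemma brC x y : lie_br x y = - lie_br y x.
Proof.
have := lie_brxx (x + y); rewrite brDl !brDr !lie_brxx add0r addr0.
by move/eqP; rewrite addr_eq0 => /eqP.
Qed.

Lemma brNl x y : lie_br (- x) y = - lie_br x y.
Proof. by rewrite -!scaleN1r brZl. Qed.

Lemma brNr x y : lie_br x (- y) = - lie_br x y.
Proof. by rewrite -!scaleN1r brZr. Qed.

Lemma br_derl x y z : lie_br x (lie_br y z) = lie_br (lie_br x y) z + lie_br y (lie_br x z).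
Proof.
have /eqP := lie_jacobi x y z; rewrite -addrA addr_eq0 => /eqP ->.
by rewrite (brC z (lie_br x y)) (brC z x) brNr opprD !opprK addrC.
Qed.

Lemma br_derr x y z : lie_br (lie_br x y) z = lie_br (lie_br x z) y + lie_br x (lie_br y z).
Proof. by rewrite (br_derl x y z) [lie_br y _]brC addrCA subrr addr0. Qed.

End LieIdentities.

Section RepLemmas.
Variables (K : numClosedFieldType) (g : lieAlgType K) (V : lmodType K).
Variable rho : lieRep g V.

Lemma rep0r x : rho x 0 = 0.
Proof. by have := rep_linr rho (-1) x 0 0; rewrite !scaleN1r !addNr. Qed.

Lemma repZr x a v : rho x (a *: v) = a *: rho x v.
Proof. by rewrite -[a *: v]addr0 rep_linr rep0r addr0. Qed.

Lemma repDr x v w : rho x (v + w) = rho x v + rho x w.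
Proof. by rewrite -{1}[v]scale1r rep_linr scale1r. Qed.

Lemma repNr x v : rho x (- v) = - rho x v.
Proof. by rewrite -!scaleN1r repZr. Qed.

Lemma rep0l v : rho 0 v = 0.
Proof. by have := rep_linl rho (-1) 0 0 v; rewrite !scaleN1r !addNr. Qed.

Lemma repZl a x v : rho (a *: x) v = a *: rho x v.
Proof. by rewrite -[a *: x]addr0 rep_linl rep0l addr0. Qed.

Lemma repNl x v : rho (- x) v = - rho x v.
Proof. by rewrite -!scaleN1r repZl. Qed.

Lemma rep_comm x y v : rho x (rho y v) = rho y (rho x v) + rho (lie_br x y) v.
Proof. by rewrite rep_br addrC subrK. Qed.

End RepLemmas.

Definition cartanA (i j : nat) : int :=
  2 * (i == j)%:Z - (i == j.+1)%:Z - (j == i.+1)%:Z.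

Section ChevalleyRelations.
Variables (K : numClosedFieldType) (g : lieAlgType K).

(** The generators are indexed by all of [nat], with relations only below [m], so that discarding
    node 0 is precomposition with the successor. *)
Record chevalleyA (m : nat) (e f h : nat -> g) : Prop := ChevalleyA {
  chEF i j : (i < m)%N -> (j < m)%N ->
    lie_br (e i) (f j) = if i == j then h i else 0;
  chHF i j : (i < m)%N -> (j < m)%N ->
    lie_br (h i) (f j) = - (cartanA i j)%:~R *: f j;
  chFF i j : (i < m)%N -> (j < m)%N -> (i.+1 < j)%N ->
    lie_br (f i) (f j) = 0;
  chFFl i : (i.+1 < m)%N -> lie_br (f i) (lie_br (f i) (f i.+1)) = 0;
  chFFr i : (i.+1 < m)%N -> lie_br (f i.+1) (lie_br (f i.+1) (f i)) = 0
}.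

Lemma chevalleyA_shift m e f h : chevalleyA m.+1 e f h ->
  chevalleyA m (fun k => e k.+1) (fun k => f k.+1) (fun k => h k.+1).
Proof.
by case=> h1 h2 h3 h4 h5; split=> [i j im jm|i j im jm|i j im jm ij|i im|i im];
  [exact: h1|exact: h2|exact: h3|exact: h4|exact: h5].
Qed.

Variables (m : nat) (e f h : nat -> g).
Hypothesis ch : chevalleyA m e f h.

(* the root vector of the negative root -(alpha_0 + ... + alpha_j) *)
Fixpoint root_vec (j : nat) : g :=
  if j is j'.+1 then lie_br (root_vec j') (f j) else f 0.

Lemma root_vec_far j i : (j.+1 < i)%N -> (i < m)%N -> lie_br (root_vec j) (f i) = 0.
Proof.
elim: j => [|j IH] ji im /=; first by apply: (chFF ch) => //; lia.
by rewrite br_derr IH ?br0l ?(chFF ch) ?br0r ?addr0 //; lia.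
Qed.

Lemma root_vec_end j : (j.+1 < m)%N -> lie_br (root_vec j.+1) (f j.+1) = 0.
Proof.
case: j => [|j] jm /=.
  by rewrite [lie_br (f 0) _]brC brNl [X in - X]brC opprK (chFFr ch).
have far := root_vec_far (ltnSn j.+1) jm.
rewrite (br_derr (root_vec j)) far br0l add0r br_derr far br0l add0r.
by rewrite [lie_br (f _) _]brC brNl [X in - X]brC opprK (chFFr ch) ?br0r.
Qed.

(** The critical case is the last interior node: with [a], [b] the last two letters, two Jacobi
    expansions of [[[r,a],b],a] give opposite values, and 2 is invertible. *)
Lemma root_vec_comm j i : (0 < i)%N -> (i <= j)%N -> (j < m)%N ->
  lie_br (root_vec j) (f i) = 0.
Proof.
elim: j => [|j IH] i0; first by move=> i0'; lia.
rewrite leq_eqVlt => /orP[/eqP -> jm|ij jm]; first exact: root_vec_end.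
have [ij'|ij'] := ltnP i j.
  rewrite /= br_derr IH ?br0l ?add0r //; try lia.
  by rewrite brC (brC _ (f i)) (chFF ch) ?oppr0 ?br0l ?oppr0 //; lia.
have {ij ij'} eij : i = j by lia. subst i.
case: j i0 IH jm => [|j] i0 IH jm; first by [].
set r := root_vec j; set a := f j.+1; set b := f j.+2.
have rb : lie_br r b = 0 by apply: root_vec_far.
have raa : lie_br (lie_br r a) a = 0 by apply: root_vec_end; lia.
have aab : lie_br (lie_br a b) a = 0 by rewrite brC (chFFl ch) ?oppr0.
rewrite -[root_vec _]/(lie_br (lie_br r a) b).
have eq1 : lie_br (lie_br (lie_br r a) b) a = lie_br (lie_br r a) (lie_br a b).
  by rewrite [lie_br (lie_br r a) b]br_derr rb br0l add0r br_derr aab br0r addr0.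
have eq2 : lie_br (lie_br (lie_br r a) b) a = - lie_br (lie_br r a) (lie_br a b).
  by rewrite br_derr raa br0l add0r [lie_br b a]brC brNr.
apply/eqP; have := eq2; rewrite -eq1 => /eqP.
rewrite -addr_eq0 -mulr2n -scaler_nat scaler_eq0 pnatr_eq0 /=; exact.
Qed.

Lemma chHroot_far i j : (j.+1 < i)%N -> (i < m)%N -> lie_br (h i) (root_vec j) = 0.
Proof.
have far k l : (k < m)%N -> (l.+1 < k)%N -> lie_br (h k) (f l) = 0.
  move=> km lk; rewrite (chHF ch) //; last by lia.
  by rewrite (_ : cartanA k l = 0) ?oppr0 ?scale0r // /cartanA; lia.
elim: j => [|j IH] ji im /=; first exact: far.
by rewrite br_derl IH ?far ?br0l ?br0r ?addr0 //; lia.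
Qed.

Lemma chHroot i : (i.+1 < m)%N -> lie_br (h i.+1) (root_vec i) = root_vec i.
Proof.
have HF1 k : (k.+1 < m)%N -> lie_br (h k.+1) (f k) = f k.
  move=> km; rewrite (chHF ch) //; last by lia.
  by rewrite (_ : cartanA _ _ = -1) ?mulrN1z ?opprK ?scale1r // /cartanA; lia.
case: i => [|i] im /=; first exact: HF1.
by rewrite br_derl chHroot_far ?HF1 ?br0l ?add0r.
Qed.

(** Only the last letter can be removed: removing an inner one leaves a bracket of a root vector
    with a non-adjacent letter, which is 0. *)
Lemma chEroot i j : (i.+1 < m)%N -> (j < m)%N ->
  lie_br (e i.+1) (root_vec j) = if i.+1 == j then - root_vec i else 0.
Proof.
elim: j i => [|j IH] i im jm /=; first by rewrite (chEF ch) //; lia.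
rewrite br_derl IH //; last by lia.
rewrite (chEF ch) // eqSS; have [<-|nij] := eqVneq i j.
  rewrite ifF; last by lia.
  by rewrite br0l add0r brC chHroot.
rewrite br0r addr0; case: eqP => [ij|]; last by rewrite br0l.
by rewrite brNl root_vec_far ?oppr0 //; lia.
Qed.

End ChevalleyRelations.

(** * Graded subspaces and singular vectors *)

(** Discarding node 0 restricts from gl(M) to gl(M - 1), which acts on the positions 1, 2, .... *)
Definition sh (T : Type) (f : nat -> T) : nat -> T := fun k => f k.+1.

Section BallotWords.

(* In a word, read from right to left, the block [iota 0 r] moves one unit from
   position [r] to position 0; the remaining letters act on positions 1, 2, ...,
   hence the shift by [succn]. *)
Fixpoint ballot_words (p : nat) : nat -> seq (seq nat) :=
  if p is p'.+1 then
    fix words_p q :=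
      (if q is q'.+1 then [seq map succn w ++ iota 0 p | w <- words_p q'] else [::])
      ++ [seq map succn w ++ iota 0 (p + q) | w <- ballot_words p' q.+1]
  else fun=> [:: [::]].

Lemma ballot_words_SS p q : ballot_words p.+1 q.+1 =
  [seq map succn w ++ iota 0 p.+1 | w <- ballot_words p.+1 q]
  ++ [seq map succn w ++ iota 0 (p.+1 + q.+1) | w <- ballot_words p q.+2].
Proof. by []. Qed.

Lemma ballot_words_S0 p : ballot_words p.+1 0 =
  [seq map succn w ++ iota 0 p.+1 | w <- ballot_words p 1].
Proof. by rewrite /= addn0. Qed.

Lemma ballot_words_neq0 p q : (0 < size (ballot_words p q))%N.
Proof.
elim: p q => [//|p IH] [|q]; first by rewrite ballot_words_S0 size_map.
by rewrite ballot_words_SS size_cat !size_map addn_gt0 IH orbT.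
Qed.

Lemma count_iota0 k r : count_mem k (iota 0 r) = (k < r)%N :> nat.
Proof. by rewrite count_uniq_mem ?iota_uniq // mem_iota. Qed.

Lemma count_map_succ k w : count_mem k.+1 (map succn w) = count_mem k w.
Proof. by rewrite count_map; apply: eq_count => x /=; rewrite eqSS. Qed.

Lemma count0_map_succ w : count_mem 0%N (map succn w) = 0%N.
Proof. by rewrite count_map; apply/eqP; rewrite -leqn0 leqNgt -has_count; apply/hasPn. Qed.

(** The common content puts all the words in a single weight space. For [q = 0] it is a tent with
    peak p, the coefficient pattern of gamma_p. *)
Lemma count_ballot p q w k : w \in ballot_words p q ->
  count_mem k w = minn (minn k.+1 p) (2 * p + q - k.+1).
Proof.
elim: p q w k => [|p IH] q w k.
  by rewrite /= inE => /eqP -> /=; rewrite minn0 min0n.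
elim: q w k => [|q IHq] w k.
  rewrite ballot_words_S0 => /mapP[u uin ->]; rewrite count_cat count_iota0.
  case: k => [|k]; first by rewrite count0_map_succ; lia.
  by rewrite count_map_succ (IH _ _ _ uin); lia.
rewrite ballot_words_SS mem_cat => /orP[] /mapP[u uin ->];
  rewrite count_cat count_iota0.
- case: k => [|k]; first by rewrite count0_map_succ; lia.
  by rewrite count_map_succ (IHq _ _ uin); lia.
- case: k => [|k]; first by rewrite count0_map_succ; lia.
  by rewrite count_map_succ (IH _ _ _ uin); lia.
Qed.

Lemma ballot_perm p q u w : u \in ballot_words p q -> w \in ballot_words p q ->
  perm_eq u w.
Proof.
by move=> uin win; apply/allP => k _ /=; rewrite (count_ballot k uin) (count_ballot k win).
Qed.

Lemma ballot_lt p q w : w \in ballot_words p q ->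
  all (fun k => k < (2 * p + q).-1)%N w.
Proof.
move=> win; apply/allP => k; rewrite -has_pred1 has_count (count_ballot k win); lia.
Qed.

End BallotWords.

Section LinearSpan.
Variables (K : numClosedFieldType) (V : lmodType K).

Inductive lspan (G : V -> Prop) : V -> Prop :=
| lspan0 : lspan G 0
| lspanL a x y : G x -> lspan G y -> lspan G (a *: x + y).

Lemma lspan_gen (G : V -> Prop) x : G x -> lspan G x.
Proof. by move=> Gx; rewrite -[x]scale1r -[1 *: x]addr0; apply: lspanL (lspan0 _). Qed.

Lemma lspan_lin (G : V -> Prop) a x y : lspan G x -> lspan G y -> lspan G (a *: x + y).
Proof.
elim=> [|b u z Gu _ IH] Gy; first by rewrite scaler0 add0r.
by rewrite scalerDr scalerA -addrA; apply: lspanL => //; apply: IH.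
Qed.

Lemma lspan_sub (G P : V -> Prop) x : P 0 ->
  (forall a u v, P u -> P v -> P (a *: u + v)) -> (forall u, G u -> P u) ->
  lspan G x -> P x.
Proof. by move=> P0 PL GP; elim=> // a u v Gu _ Pv; apply: PL => //; apply: GP. Qed.

End LinearSpan.

Section GradedSingular.
Variables (K : numClosedFieldType) (g : lieAlgType K) (V : lmodType K).
Variable rho : lieRep g V.
Variable Gam : zmodType.
Implicit Types (e f h : nat -> g) (gam : nat -> Gam) (W Y : Gam -> V -> Prop).

Definition actw f (w : seq nat) (v : V) : V := foldr (fun k x => rho (f k) x) v w.

Lemma actw_cat f u w v : actw f (u ++ w) v = actw f u (actw f w v).
Proof. exact: foldr_cat. Qed.

Lemma actw_sh f w v : actw (sh f) w v = actw f (map succn w) v.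
Proof. by elim: w => //= k w ->. Qed.

Definition wdeg gam (w : seq nat) : Gam := \sum_(k <- w) gam k.

Lemma wdeg_cons gam k w : wdeg gam (k :: w) = gam k + wdeg gam w.
Proof. exact: big_cons. Qed.

Lemma wdeg_cat gam u w : wdeg gam (u ++ w) = wdeg gam u + wdeg gam w.
Proof. exact: big_cat. Qed.

Lemma wdeg_sh gam w : wdeg (sh gam) w = wdeg gam (map succn w).
Proof. by rewrite /wdeg big_map. Qed.

Lemma wdeg_perm gam u w : perm_eq u w -> wdeg gam u = wdeg gam w.
Proof. exact: perm_big. Qed.

Lemma wdeg_iotaS gam j : wdeg gam (iota 0 j.+1) = wdeg gam (iota 0 j) + gam j.
Proof. by rewrite -addn1 iotaD wdeg_cat add0n /wdeg big_seq1. Qed.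

(* [W d x] means that [x] lies in the degree [d] part of the graded subspace [W];
   [f k] raises degrees by [gam k]. *)
Record gstable m e f h gam W : Prop := Gstable {
  gs0 d : W d 0;
  gsL d a x y : W d x -> W d y -> W d (a *: x + y);
  gsF d k x : (k < m)%N -> W d x -> W (d + gam k) (rho (f k) x);
  gsE d k x : (k < m)%N -> W d x -> W (d - gam k) (rho (e k) x);
  gsH d k x : (k < m)%N -> W d x -> W d (rho (h k) x)
}.

Lemma gsD m e f h gam W d x y : gstable m e f h gam W -> W d x -> W d y -> W d (x + y).
Proof. by move=> st Wx Wy; rewrite -[x]scale1r; apply: (gsL st). Qed.

Lemma gsN m e f h gam W d x : gstable m e f h gam W -> W d x -> W d (- x).
Proof.
by move=> st Wx; rewrite -scaleN1r -[_ *: _]addr0; apply: (gsL st) => //; apply: (gs0 st).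
Qed.

Lemma gsB m e f h gam W d x y : gstable m e f h gam W -> W d x -> W d y -> W d (x - y).
Proof. by move=> st Wx Wy; apply: (gsD st) => //; apply: (gsN st). Qed.

Lemma gsZ m e f h gam W d a x : gstable m e f h gam W -> W d x -> W d (a *: x).
Proof.
by move=> st Wx; rewrite -[_ *: _]addr0; apply: (gsL st) => //; apply: (gs0 st).
Qed.

Lemma gstable_sh m e f h gam W : gstable m.+1 e f h gam W ->
  gstable m (sh e) (sh f) (sh h) (sh gam) W.
Proof.
case=> w0 wL wF wE wH.
by split=> [//|//|d k x km|d k x km|d k x km]; [exact: wF|exact: wE|exact: wH].
Qed.

Record singular_mod m e h gam W (lam : nat -> int) (v : V) (d : Gam) : Prop := SingularMod {
  sgE k : (k < m)%N -> W (d - gam k) (rho (e k) v);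
  sgH k : (k < m)%N -> rho (h k) v = (lam k)%:~R *: v
}.

Inductive cyclic_mod m f gam W (v : V) (d : Gam) : Gam -> V -> Prop :=
| cycW d' x : W d' x -> cyclic_mod m f gam W v d d' x
| cycv : cyclic_mod m f gam W v d d v
| cycL d' a x y : cyclic_mod m f gam W v d d' x -> cyclic_mod m f gam W v d d' y ->
    cyclic_mod m f gam W v d d' (a *: x + y)
| cycF d' k x : (k < m)%N -> cyclic_mod m f gam W v d d' x ->
    cyclic_mod m f gam W v d (d' + gam k) (rho (f k) x).

(** The definition closes under lowering only; [e k] and [h k] are commuted past the lowering
    operators until they meet [v] or [W]. *)
Lemma cyclic_mod_stable m e f h gam W lam v d :
  chevalleyA m e f h -> gstable m e f h gam W -> singular_mod m e h gam W lam v d ->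
  gstable m e f h gam (cyclic_mod m f gam W v d).
Proof.
move=> ch st sg.
have C0 d' : cyclic_mod m f gam W v d d' 0 by apply/cycW/(gs0 st).
have CZ d' a x : cyclic_mod m f gam W v d d' x -> cyclic_mod m f gam W v d d' (a *: x).
  by move=> Cx; rewrite -[_ *: _]addr0; apply: cycL.
have CD d' x y : cyclic_mod m f gam W v d d' x -> cyclic_mod m f gam W v d d' y ->
    cyclic_mod m f gam W v d d' (x + y).
  by move=> Cx Cy; rewrite -[x]scale1r; apply: cycL.
have CH d' k x : (k < m)%N -> cyclic_mod m f gam W v d d' x ->
    cyclic_mod m f gam W v d d' (rho (h k) x).
  move=> km; elim=> [d1 y Wy||d1 a y z _ IHy _ IHz|d1 j y jm Cy IH].
  - exact/cycW/(gsH st).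
  - by rewrite (sgH sg) //; apply/CZ/cycv.
  - by rewrite rep_linr; apply: cycL.
  - rewrite rep_comm (chHF ch) // repZl; apply: CD; last by apply/CZ/cycF.
    exact: cycF.
split=> //; first by move=> *; apply: cycL.
  by move=> *; apply: cycF.
move=> d' k x km; elim=> [d1 y Wy||d1 a y z _ IHy _ IHz|d1 j y jm Cy IH].
- exact/cycW/(gsE st).
- exact/cycW/(sgE sg).
- by rewrite rep_linr; apply: cycL.
- rewrite rep_comm (chEF ch) //; apply: CD; first by rewrite addrAC; apply: cycF.
  by case: eqP => [->|_]; [rewrite addrK; apply: CH|rewrite rep0l].
Qed.

Lemma cyclic_mod_words m f gam W v d d' x :
  (forall d k y, (k < m)%N -> W d y -> W (d + gam k) (rho (f k) y)) ->
  cyclic_mod m f gam W v d d' x ->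
  lspan (fun y => W d' y \/
    exists u, [/\ all (fun k => k < m)%N u, d + wdeg gam u = d' & y = actw f u v]) x.
Proof.
move=> WF; elim=> [d1 y Wy||d1 a y z _ IHy _ IHz|d1 j y jm _ IH].
- by apply: lspan_gen; left.
- by apply: lspan_gen; right; exists [::]; rewrite /wdeg big_nil addr0.
- exact: lspan_lin.
- elim: IH => [|b u z Gu _ IHz]; first by rewrite rep0r; apply: lspan0.
  rewrite rep_linr; apply: lspanL => //.
  case: Gu => [Wu|[u' [mu' <- ->]]]; first by left; apply: WF.
  by right; exists (j :: u'); rewrite /= jm mu' wdeg_cons -addrA (addrC (gam j)).
Qed.

(* This is where integrability enters, by sl2-theory. *)
Lemma singular_weight0 m e f h gam W lam v d k :
  chevalleyA m e f h -> gstable m e f h gam W -> singular_mod m e h gam W lam v d ->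
  (k < m)%N -> lam k = 0 -> (exists M, iter M (rho (f k)) (rho (f k) v) = 0) ->
  W (d + gam k) (rho (f k) v).
Proof.
move=> ch st sg km lk0 [M].
pose y j := iter j (rho (f k)) (rho (f k) v).
have efh z : rho (e k) (rho (f k) z) = rho (f k) (rho (e k) z) + rho (h k) z.
  by rewrite rep_comm (chEF ch) // eqxx.
have hf z : rho (h k) (rho (f k) z) = rho (f k) (rho (h k) z) - 2%:R *: rho (f k) z.
  rewrite rep_comm (chHF ch) // repZl (_ : cartanA k k = 2) ?scaleNr //.
  by rewrite /cartanA; lia.
have hy j : rho (h k) (y j) = - (2 * j.+1)%:R *: y j.
  elim: j => [|j IH]; first by rewrite /y /= hf (sgH sg) // lk0 scale0r rep0r add0r scaleNr.
  rewrite [y j.+1]/(rho (f k) (y j)) hf IH repZr -scaleNr -scalerDl.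
  by congr (_ *: _); rewrite -opprD -natrD; congr (- _%:R); lia.
(* Modulo [W], e f^(j+2) v = -(j+1)(j+2) f^(j+1) v, as for an sl2-vector of weight 0; here [y j] is
   f^(j+1) v. *)
have ey j : W (d + gam k *+ j.+1) (rho (e k) (y j.+1) + (j.+1 * j.+2)%:R *: y j).
  elim: j => [|j IH].
    rewrite -[y 1%N]/(rho (f k) (y 0%N)) efh hy -addrA -scalerDl addNr scale0r addr0 mulr1n.
    apply: (gsF st) => //; rewrite -[y 0%N]/(rho (f k) v) efh (sgH sg) // lk0 scale0r addr0.
    by rewrite -[d](subrK (gam k)); apply: (gsF st) => //; apply: (sgE sg).
  have := gsF st km IH; rewrite -addrA -mulrSr repDr repZr -[rho (f k) (y j)]/(y j.+1).
  congr (W _ _); rewrite -[y j.+2]/(rho (f k) (y j.+1)) efh -addrA; congr (_ + _).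
  rewrite hy -scalerDl; congr (_ *: _); rewrite addrC -natrB; last by lia.
  by congr (_%:R); lia.
rewrite -/(y M) => yM.
(* The factor being nonzero, membership in [W] descends from [y j.+1] to [y j]; nilpotency supplies
   the start [y M = 0]. *)
have desc j : W (d + gam k *+ j.+1) (y j) -> W (d + gam k) (y 0%N).
  elim: j => [//|j IH] Wy; apply: IH.
  have := gsE st km Wy; rewrite mulrSr addrA addrK => We.
  have := gsB st (ey j) We; rewrite [X in X - _]addrC addrK => /(gsZ (j.+1 * j.+2)%:R^-1 st).
  by rewrite scalerA mulVf ?scale1r // pnatr_eq0.
by apply: (desc M); rewrite yM; apply: (gs0 st).
Qed.

End GradedSingular.

(** * Upper bound *)

Section LowerRank.
Variables (K : numClosedFieldType) (g : lieAlgType K) (V : lmodType K).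
Variable rho : lieRep g V.
Variable Gam : zmodType.
Variables (m : nat) (e f h : nat -> g) (gam : nat -> Gam).
Variables (W Y : Gam -> V -> Prop) (lam : nat -> int) (v : V) (d : Gam).
Hypothesis ch : chevalleyA m.+1 e f h.
Hypothesis st : gstable rho m.+1 e f h gam W.
Hypothesis sg : singular_mod rho m.+1 e h gam W lam v d.
Hypothesis stY : gstable rho m (sh e) (sh f) (sh h) (sh gam) Y.
Hypothesis WY : forall d' x, W d' x -> Y d' x.

Local Notation R := (root_vec f).
Local Notation act := (@actw _ _ _ rho).

Lemma root_vec_stable j d' x : (j < m.+1)%N -> W d' x ->
  W (d' + wdeg gam (iota 0 j.+1)) (rho (R j) x).
Proof.
elim: j d' x => [|j IH] d' x jm Wx.
  by rewrite wdeg_iotaS [wdeg _ _]big_nil add0r; apply: (gsF st).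
rewrite -[R j.+1]/(lie_br (R j) (f j.+1)) rep_br wdeg_iotaS; apply: (gsB st).
  rewrite (addrC (wdeg _ _)) addrA.
  by apply: IH; [lia|apply: (gsF st)].
by rewrite addrA; apply: (gsF st) => //; apply: IH => //; lia.
Qed.

Lemma lower_rank_gsF k d' x : (0 < k < m.+1)%N -> Y d' x -> Y (d' + gam k) (rho (f k) x).
Proof. by case: k => // k /andP[_ km] Yx; apply: (gsF stY). Qed.

Lemma lower_rank_actw w d' x : all (fun k => 0 < k < m.+1)%N w -> Y d' x ->
  Y (d' + wdeg gam w) (act f w x).
Proof.
elim: w => [|k w IH] /=; first by rewrite /wdeg big_nil addr0.
case/andP=> km wm Yx; rewrite wdeg_cons addrCA addrC.
by apply: lower_rank_gsF => //; apply: IH.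
Qed.

Lemma root_vec_actw t w x : all (fun k => t.+1 < k < m.+1)%N w ->
  rho (R t) (act f w x) = act f w (rho (R t) x).
Proof.
elim: w => //= k w IH /andP[/andP[tk km] wm].
by rewrite rep_comm IH // (root_vec_far ch) // rep0l addr0.
Qed.

(* Modulo [Y], the root vector [R j] acts on [v] as f_0 f_1 ... f_j: in the
   expansion of the iterated bracket, every other term has some [R i v] with
   [i < j] as a factor. *)
Lemma root_vec_word j : (j < m.+1)%N ->
  (forall i, (i < j)%N -> Y (d + wdeg gam (iota 0 i.+1)) (rho (R i) v)) ->
  Y (d + wdeg gam (iota 0 j.+1)) (rho (R j) v - act f (iota 0 j.+1) v).
Proof.
move=> jm Yv.
(* Passing from [t] to [t.+1] replaces R_t f_(t+1) by the bracket; the difference f_(t+1) ... f_j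
   R_t v lies in [Y]. *)
have claim t : (t <= j)%N -> Y (d + wdeg gam (iota 0 j.+1))
    (rho (R t) (act f (iota t.+1 (j - t)) v) - act f (iota 0 j.+1) v).
  elim: t => [|t IH] tj; first by rewrite subn0 subrr; apply: (gs0 stY).
  have := IH (ltnW tj); rewrite (_ : j - t = (j - t.+1).+1)%N; last by lia.
  rewrite /= rep_br; set z := actw _ _ _ _ => Yt.
  rewrite addrAC; apply: (gsB stY) => //.
  have zE : rho (R t) z = act f (iota t.+2 (j - t.+1)) (rho (R t) v).
    by apply: root_vec_actw; apply/allP => k; rewrite mem_iota; lia.
  rewrite zE -[rho (f t.+1) _]/(act f (t.+1 :: iota t.+2 (j - t.+1)) _).
  have -> : d + wdeg gam (iota 0 j.+1) =
      d + wdeg gam (iota 0 t.+1) + wdeg gam (t.+1 :: iota t.+2 (j - t.+1)).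
    rewrite -addrA -wdeg_cat; congr (_ + wdeg _ _).
    have -> : (j.+1 = t.+1 + (j - t.+1).+1)%N by lia.
    by rewrite iotaD.
  apply: lower_rank_actw; last exact: Yv.
  by rewrite /=; apply/andP; split; [lia|apply/allP => k; rewrite mem_iota; lia].
by have := claim j (leqnn j); rewrite subnn.
Qed.

Lemma weight_actw i w c x : (i < m.+1)%N -> all (fun k => k < m.+1)%N w ->
  rho (h i) x = c%:~R *: x ->
  rho (h i) (act f w x) = (c - \sum_(k <- w) cartanA i k)%:~R *: act f w x.
Proof.
move=> im + hx; elim: w => [|k w IH] /=; first by rewrite big_nil subr0.
case/andP=> km wm; rewrite rep_comm IH // repZr (chHF ch) // repZl -scalerDl.
by congr (_ *: _); rewrite big_cons -rmorphN -rmorphD /=; congr (_%:~R); lia.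
Qed.

Lemma sum_cartanA i r :
  \sum_(k <- iota 0 r) cartanA i.+1 k = (i.+2 == r)%:Z - (i.+1 == r)%:Z.
Proof.
elim: r => [|r IH]; first by rewrite big_nil.
rewrite -addn1 iotaD big_cat IH add0n big_seq1 /= /cartanA; lia.
Qed.

(** Modulo [Y] the vector is R_j v. A raising operator at a node k >= 1 sends this to R_j e_k v,
    which lies in [W], plus -R_(j-1) v when k = j, which lies in [Y] by hypothesis. *)
Lemma singular_lower j mu : (j < m.+1)%N ->
  (forall i, (i < j)%N -> Y (d + wdeg gam (iota 0 i.+1)) (rho (R i) v)) ->
  (forall k, (k < m)%N -> mu k = lam k.+1 - (k.+2 == j.+1)%:Z + (k.+1 == j.+1)%:Z) ->
  singular_mod rho m (sh e) (sh h) (sh gam) Y mu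
    (act f (iota 0 j.+1) v) (d + wdeg gam (iota 0 j.+1)).
Proof.
move=> jm Yv muE; split=> k km; last first.
  rewrite /sh (weight_actw (c := lam k.+1)) //; last exact: (sgH sg).
    by rewrite sum_cartanA muE // opprB addrA addrAC.
  by apply/allP => i; rewrite mem_iota; lia.
rewrite /sh; set d1 := d + _; set v1 := actw _ _ _ _.
have -> : v1 = rho (R j) v - (rho (R j) v - v1) by rewrite subKr.
rewrite repDr repNr; apply: (gsB stY); last first.
  by apply: (gsE stY) => //; apply: root_vec_word.
rewrite rep_comm; apply: (gsD stY).
  rewrite /d1 addrAC; apply: WY; apply: root_vec_stable => //.
  by apply: (sgE sg).
rewrite (chEroot ch) //; case: eqP => [kj|_]; last by rewrite rep0l; apply: (gs0 stY).
rewrite repNl; apply: (gsN stY).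
by rewrite /d1 -kj wdeg_iotaS addrA addrK; apply: Yv; lia.
Qed.

(** Commuting R_j past a letter k >= 1 costs nothing unless k = j + 1, when the cost is R_(j+1); so
    the induction on [w] treats all j at once. *)
Lemma root_vec_word_stable w j :
  (forall i, (i < m.+1)%N -> Y (d + wdeg gam (iota 0 i.+1)) (rho (R i) v)) ->
  all (fun k => 0 < k < m.+1)%N w -> (j < m.+1)%N ->
  Y (d + wdeg gam (iota 0 j.+1) + wdeg gam w) (rho (R j) (act f w v)).
Proof.
move=> Yv; elim: w j => [|k w IH] j /=; first by rewrite /wdeg big_nil addr0 => _; apply: Yv.
case/andP=> km wm jm; rewrite (wdeg_cons gam k w) rep_comm; apply: (gsD stY).
  by rewrite addrCA addrC; apply: lower_rank_gsF => //; apply: IH.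
have [kj|jk] := leqP k j.
  rewrite (root_vec_comm ch) ?rep0l //; last by lia.
  exact: (gs0 stY).
have [->|kj1] := eqVneq k j.+1.
  rewrite -[lie_br _ _]/(R j.+1) addrA -(addrA d) -(wdeg_iotaS gam j.+1).
  by apply: IH => //; lia.
by rewrite (root_vec_far ch) ?rep0l; [apply: (gs0 stY)|lia|lia].
Qed.

(** Where [lam] vanishes, f_j v lies in [W], so R_j v agrees modulo [W] with -f_j R_(j-1) v: nothing
    new appears between two jumps of the weight. *)
Lemma root_vec_chain a j :
  (forall k x, (k < m.+1)%N -> exists M, iter M (rho (f k)) x = 0) ->
  (a <= j)%N -> (j < m.+1)%N -> (forall i, (a < i <= j)%N -> lam i = 0) ->
  Y (d + wdeg gam (iota 0 a.+1)) (rho (R a) v) ->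
  Y (d + wdeg gam (iota 0 j.+1)) (rho (R j) v).
Proof.
move=> nilp; elim: j => [|j IH] aj jm lam0 Ya; first by move: Ya; rewrite (_ : a = 0%N) //; lia.
have [aj'|ja] := leqP a j; last by rewrite (_ : j.+1 = a) //; lia.
have Wf : W (d + gam j.+1) (rho (f j.+1) v).
  by apply: (singular_weight0 ch st sg) => //; [apply: lam0; lia|apply: nilp].
rewrite -[R j.+1]/(lie_br (R j) (f j.+1)) rep_br (wdeg_iotaS gam j.+1).
apply: (gsB stY).
  by rewrite (addrC (wdeg _ _)) addrA; apply/WY/root_vec_stable => //; lia.
rewrite addrA; apply: lower_rank_gsF; first by lia.
by apply: IH => // [|i ij]; [lia|apply: lam0; lia].
Qed.

(** f_0 is R_0; the letters on its right are handled by [root_vec_word_stable], and those on its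
    left preserve [Y]. *)
Lemma linear_word_stable u :
  (forall i, (i < m.+1)%N -> Y (d + wdeg gam (iota 0 i.+1)) (rho (R i) v)) ->
  all (fun k => k < m.+1)%N u -> count_mem 0%N u = 1%N ->
  Y (d + wdeg gam u) (act f u v).
Proof.
move=> Yv um u1.
have u0 : 0%N \in u by rewrite -has_pred1 has_count u1.
case/splitPr: u0 um u1 => u1 u2; rewrite all_cat count_cat /= => /andP[m1 m2].
rewrite addnCA => /eqP; rewrite eqSS addn_eq0 => /andP[/eqP c1 /eqP c2].
have pos s : all (fun k => k < m.+1)%N s -> count_mem 0%N s = 0%N ->
    all (fun k => 0 < k < m.+1)%N s.
  move=> /allP sm s0; apply/allP => k ks; rewrite sm // andbT lt0n; apply/eqP => k0.
  by move: ks; rewrite k0 -has_pred1 has_count s0.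
rewrite actw_cat /= wdeg_cat wdeg_cons.
have -> : d + (wdeg gam u1 + (gam 0 + wdeg gam u2)) =
    d + wdeg gam (iota 0 1) + wdeg gam u2 + wdeg gam u1.
  rewrite wdeg_iotaS [wdeg _ (iota 0 0)]big_nil add0r -!addrA; congr (_ + _).
  by rewrite [LHS]addrC -addrA.
apply: lower_rank_actw; first exact: pos.
by apply: (@root_vec_word_stable u2 0%N) => //; apply: pos.
Qed.

End LowerRank.

(* The values of the weight (0^p, 1^q, 2^p) on the simple coroots: it jumps at
   positions [p] and [p + q], and not at all if [p = 0]. *)
Definition two_step (p q k : nat) : int :=
  if p is 0 then 0 else (k.+1 == p)%:Z + (k.+1 == p + q)%:Z.

Section UpperBound.
Variables (K : numClosedFieldType) (g : lieAlgType K) (V : lmodType K).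
Variable rho : lieRep g V.
Variable Gam : zmodType.

(** Induction on p, then on q: the first vector of the restriction trades q for q - 1, the second
    (p, q) for (p - 1, q + 1). [W] is arbitrary so that the second can be taken modulo what the
    first generates. By [free], a degree determines the letters of a word. *)
Theorem ballot_span p q m e f h (gam : nat -> Gam) W v d w0 :
  m = (2 * p + q).-1 -> chevalleyA m e f h -> gstable rho m e f h gam W ->
  singular_mod rho m e h gam W (two_step p q) v d ->
  (forall k x, (k < m)%N -> exists M, iter M (rho (f k)) x = 0) ->
  (forall u w, all (fun k => k < m)%N u -> all (fun k => k < m)%N w ->
     wdeg gam u = wdeg gam w -> perm_eq u w) ->
  w0 \in ballot_words p q ->
  forall x, cyclic_mod rho m f gam W v d (d + wdeg gam w0) x ->
  lspan (fun y => W (d + wdeg gam w0) y \/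
                  exists2 w, w \in ballot_words p q & y = actw rho f w v) x.
Proof.
elim: p q m e f h gam W v d w0 => [|p IHp].
  move=> q m e f h gam W v d w0 mE ch st sg nilp free.
  rewrite inE => /eqP -> x /(cyclic_mod_words (fun d k y km Wy => gsF st km Wy)).
  apply: lspan_sub; first exact: lspan0.
    by move=> *; apply: lspan_lin.
  move=> u [Wu|[w [wm /addrI dw ->]]]; apply: lspan_gen; first by left.
  right; exists w => //; rewrite inE -size_eq0.
  by rewrite (perm_size (free w [::] wm isT dw)).
elim/ltn_ind=> q IHq m e f h gam W v d w0 mE ch st sg nilp free w0in x Cx.
pose m' := (2 * p + q)%N; have {}mE : m = m'.+1 by lia.
subst m; set D := d + wdeg gam w0 in Cx *.
have st' := gstable_sh st; have ch' := chevalleyA_shift ch.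
have nilp' k y : (k < m')%N -> exists M, iter M (rho (sh f k)) y = 0 by move=> km; apply: nilp.
have free' u w : all (fun k => k < m')%N u -> all (fun k => k < m')%N w ->
    wdeg (sh gam) u = wdeg (sh gam) w -> perm_eq u w.
  move=> um wm; rewrite !wdeg_sh => /free; rewrite !all_map => /(_ um wm).
  by apply: perm_map_inj; apply: succn_inj.
have pw0 w : w \in ballot_words p.+1 q -> wdeg gam w0 = wdeg gam w.
  by move=> win; apply/wdeg_perm/(ballot_perm w0in).
(* The weight is 0 on the first p + 1 positions, so R_i v lies in [W] for i < p. *)
have Rlow i : (i < p)%N -> W (d + wdeg gam (iota 0 i.+1)) (rho (root_vec f i) v).
  move=> ip; apply: (root_vec_chain ch st sg st' (fun _ _ H => H) nilp (leq0n i)) => //.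
  - by rewrite /m'; lia.
  - by move=> k ki; rewrite /two_step; lia.
  - rewrite wdeg_iotaS [wdeg _ _]big_nil add0r /=.
    apply: (singular_weight0 ch st sg) => //; last exact: nilp.
    by rewrite /two_step; lia.
set target := lspan _.
(* [C1] is generated over [W] by the first vector. That vector needs an entry 1 in the weight, so
   [C1] is [W] itself when q = 0. *)
have [C1 [st1 WC1 Rmid C1target]] : exists C1 : Gam -> V -> Prop,
    [/\ gstable rho m' (sh e) (sh f) (sh h) (sh gam) C1,
        forall d' y, W d' y -> C1 d' y,
        forall i, (i < p + q)%N -> C1 (d + wdeg gam (iota 0 i.+1)) (rho (root_vec f i) v)
      & forall y, C1 D y -> target y].
  case: q @m' IHq ch st sg nilp free w0in Cx st' ch' nilp' free' pw0 @target =>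
      [|q] m' IHq ch st sg nilp free w0in Cx st' ch' nilp' free' pw0 target.
    exists W; split=> // [i|y Wy]; first by rewrite addn0; apply: Rlow.
    by apply: lspan_gen; left.
  pose v1 := actw rho f (iota 0 p.+1) v; pose d1 := d + wdeg gam (iota 0 p.+1).
  have sg1 : singular_mod rho m' (sh e) (sh h) (sh gam) W (two_step p.+1 q) v1 d1.
    apply: (singular_lower ch st sg st') => // [|k km]; last by rewrite /two_step; lia.
    by rewrite /m'; lia.
  pose C1 := cyclic_mod rho m' (sh f) (sh gam) W v1 d1.
  have st1 : gstable rho m' (sh e) (sh f) (sh h) (sh gam) C1.
    exact: cyclic_mod_stable ch' st' sg1.
  have WC1 d' y : W d' y -> C1 d' y by apply: cycW.
  have Rp : C1 d1 (rho (root_vec f p) v).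
    rewrite -[rho _ _](subrK v1); apply: (gsD st1); last exact: cycv.
    by apply: WC1; apply: (root_vec_word ch st') => //; rewrite /m'; lia.
  exists C1; split=> // [i ipq|y C1y].
    have [ip|pi] := ltnP i p; first exact/WC1/Rlow.
    apply: (root_vec_chain ch st sg st1 WC1 nilp pi) => //; first by rewrite /m'; lia.
    by move=> k ki; rewrite /two_step; lia.
  have [w1 w1in] : exists w1, w1 \in ballot_words p.+1 q.
    by have := ballot_words_neq0 p.+1 q; case: ballot_words => // w s _; exists w; rewrite mem_head.
  have in1 w : w \in ballot_words p.+1 q ->
      map succn w ++ iota 0 p.+1 \in ballot_words p.+1 q.+1.
    by move=> win; rewrite ballot_words_SS mem_cat (map_f (fun w => map succn w ++ _)).
  have D1 : D = d1 + wdeg (sh gam) w1.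
    by rewrite /D (pw0 _ (in1 _ w1in)) wdeg_cat wdeg_sh addrA addrAC.
  rewrite D1 in C1y.
  have mE1 : m' = (2 * p.+1 + q).-1 by rewrite /m'; lia.
  have := IHq q (ltnSn q) _ _ _ _ _ _ _ _ _ mE1 ch' st' sg1 nilp' free' w1in y C1y.
  rewrite -D1; apply: lspan_sub; first exact: lspan0.
    by move=> *; apply: lspan_lin.
  move=> z [Wz|[w win ->]]; apply: lspan_gen; [by left|right].
  exists (map succn w ++ iota 0 p.+1); first exact: in1.
  by rewrite actw_cat actw_sh.
(* The second vector moves a unit from the first entry 2, at position p + q + 1, to position 0. *)
pose v2 := actw rho f (iota 0 (p + q).+1) v.
pose d2 := d + wdeg gam (iota 0 (p + q).+1).
have sg2 : singular_mod rho m' (sh e) (sh h) (sh gam) C1 (two_step p q.+1) v2 d2.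
  apply: (singular_lower ch st sg st1) => //; first by rewrite /m'; lia.
  by move=> k; rewrite /m' /two_step; case: (p) => [|p'] km; lia.
pose C2 := cyclic_mod rho m' (sh f) (sh gam) C1 v2 d2.
have st2 : gstable rho m' (sh e) (sh f) (sh h) (sh gam) C2.
  exact: cyclic_mod_stable ch' st1 sg2.
have C12 d' y : C1 d' y -> C2 d' y by apply: cycW.
have WC2 d' y : W d' y -> C2 d' y by move=> Wy; apply/C12/WC1.
have Rpq : C2 d2 (rho (root_vec f (p + q)) v).
  rewrite -[rho _ _](subrK v2); apply: (gsD st2); last exact: cycv.
  by apply: C12; apply: (root_vec_word ch st1) => //; rewrite /m'; lia.
have Rall i : (i < m'.+1)%N -> C2 (d + wdeg gam (iota 0 i.+1)) (rho (root_vec f i) v).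
  move=> im; have [ip|pi] := ltnP i (p + q); first exact/C12/Rmid.
  apply: (root_vec_chain ch st sg st2 WC2 nilp pi) => //.
  by move=> k; rewrite /m' /two_step; lia.
(* By [count_ballot], words of this degree contain f_0 exactly once. *)
have {Cx} C2x : C2 D x.
  move: Cx => /(cyclic_mod_words (fun d k y km Wy => gsF st km Wy)).
  apply: lspan_sub; first exact: (gs0 st2).
    by move=> *; apply: (gsL st2).
  move=> y [/WC2 //|[u [um /addrI du ->]]].
  have pu : perm_eq u w0.
    by apply: free => //; apply: sub_all (ballot_lt w0in) => k; rewrite /m'; lia.
  rewrite /D -du; apply: (linear_word_stable ch st2) => //.
  by rewrite (seq.permP pu) (count_ballot _ w0in); lia.
have [w2 w2in] : exists w2, w2 \in ballot_words p q.+1.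
  by have := ballot_words_neq0 p q.+1; case: ballot_words => // w s _; exists w; rewrite mem_head.
have in2 w : w \in ballot_words p q.+1 ->
    map succn w ++ iota 0 (p + q).+1 \in ballot_words p.+1 q.
  case: (q) => [|q'] win.
    by rewrite ballot_words_S0 addn0 (map_f (fun w => map succn w ++ _)).
  by rewrite ballot_words_SS -addSn mem_cat (map_f (fun w => map succn w ++ _) win) orbT.
have D2 : D = d2 + wdeg (sh gam) w2.
  by rewrite /D (pw0 _ (in2 _ w2in)) wdeg_cat wdeg_sh addrA addrAC.
rewrite D2 in C2x.
have mE2 : m' = (2 * p + q.+1).-1 by rewrite /m'; lia.
have := IHp _ _ _ _ _ _ _ _ _ _ mE2 ch' st1 sg2 nilp' free' w2in x C2x.
rewrite -D2; apply: lspan_sub; first exact: lspan0.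
  by move=> *; apply: lspan_lin.
move=> y [/C1target //|[w win ->]].
apply: lspan_gen; right; exists (map succn w ++ iota 0 (p + q).+1); first exact: in2.
by rewrite actw_cat actw_sh.
Qed.

End UpperBound.

(** * The two-column model *)

Section TwoColumnModel.
Variable K : numClosedFieldType.

(* A configuration lists, for each position, whether it is occupied in the
   first and in the second column; functions on configurations of length N
   model the tensor square of the exterior algebra of K^N. *)
Definition site := (bool * bool)%type.
Implicit Types (x y : seq site -> K) (d : seq site).

(** The value at [d] collects the configurations from which [d] arises by moving an occupant of one
    column from position k + 1 to k. The positions are adjacent, so the exterior algebra contributes
    no signs. *)
Fixpoint hopF k x d : K :=
  match k, d with
  | 0%N, a :: b :: z =>
      (a.1 && ~~ b.1)%:R * x ((false, a.2) :: (true, b.2) :: z)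
      + (a.2 && ~~ b.2)%:R * x ((a.1, false) :: (b.1, true) :: z)
  | k'.+1, a :: z => hopF k' (fun z => x (a :: z)) z
  | _, _ => 0
  end.

Fixpoint hopE k x d : K :=
  match k, d with
  | 0%N, a :: b :: z =>
      (~~ a.1 && b.1)%:R * x ((true, a.2) :: (false, b.2) :: z)
      + (~~ a.2 && b.2)%:R * x ((a.1, true) :: (b.1, false) :: z)
  | k'.+1, a :: z => hopE k' (fun z => x (a :: z)) z
  | _, _ => 0
  end.

Fixpoint hopH k x d : K :=
  match k, d with
  | 0%N, a :: b :: z =>
      (b.1%:R + b.2%:R - a.1%:R - a.2%:R) * x (a :: b :: z)
  | k'.+1, a :: z => hopH k' (fun z => x (a :: z)) z
  | _, _ => 0
  end.

Lemma hopF_lin k a b x y d :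
  hopF k (fun z => a * x z + b * y z) d = a * hopF k x d + b * hopF k y d.
Proof.
elim: k x y d => [|k IH] x y d.
  by case: d => [|a1 [|b1 d]] /=; ring.
by case: d => [|a1 d] /=; [ring|rewrite IH].
Qed.

Lemma hopE_lin k a b x y d :
  hopE k (fun z => a * x z + b * y z) d = a * hopE k x d + b * hopE k y d.
Proof.
elim: k x y d => [|k IH] x y d.
  by case: d => [|a1 [|b1 d]] /=; ring.
by case: d => [|a1 d] /=; [ring|rewrite IH].
Qed.

Lemma hopH_lin k a b x y d :
  hopH k (fun z => a * x z + b * y z) d = a * hopH k x d + b * hopH k y d.
Proof.
elim: k x y d => [|k IH] x y d.
  by case: d => [|a1 [|b1 d]] /=; ring.
by case: d => [|a1 d] /=; [ring|rewrite IH].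
Qed.

Lemma hopF_scale k a x d : hopF k (fun z => a * x z) d = a * hopF k x d.
Proof.
transitivity (hopF k (fun z => a * x z + 0 * x z) d).
  by congr hopF; apply: funext => z; rewrite mul0r addr0.
by rewrite hopF_lin mul0r addr0.
Qed.

Lemma hopE_scale k a x d : hopE k (fun z => a * x z) d = a * hopE k x d.
Proof.
transitivity (hopE k (fun z => a * x z + 0 * x z) d).
  by congr hopE; apply: funext => z; rewrite mul0r addr0.
by rewrite hopE_lin mul0r addr0.
Qed.

Lemma hopH_scale k a x d : hopH k (fun z => a * x z) d = a * hopH k x d.
Proof.
transitivity (hopH k (fun z => a * x z + 0 * x z) d).
  by congr hopH; apply: funext => z; rewrite mul0r addr0.
by rewrite hopH_lin mul0r addr0.
Qed.

Lemma hopEF i j x d :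
  hopE i (hopF j x) d = hopF j (hopE i x) d + (if i == j then hopH i x d else 0).
Proof.
elim: i j x d => [|i IH] [|j] x d.
- case: d => [|a [|b z]] /=; rewrite ?addr0 //.
  by case: a => -[] []; case: b => -[] [] /=; ring.
- case: j => [|j].
    case: d => [|a [|b [|c z]]] /=; rewrite ?mulr0 ?addr0 //.
    by case: a => -[] []; case: b => -[] []; case: c => -[] [] /=; ring.
  case: d => [|a [|b z]] /=; rewrite ?addr0 //.
  by rewrite hopF_lin.
- case: i {IH} => [|i].
    case: d => [|a [|b [|c z]]] /=; rewrite ?mulr0 ?addr0 //.
    by case: a => -[] []; case: b => -[] []; case: c => -[] [] /=; ring.
  case: d => [|a [|b z]] /=; rewrite ?addr0 //.
  by rewrite hopE_lin.
- case: d => [|a z] /=; first by case: eqP; rewrite addr0.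
  by rewrite -IH.
Qed.

(** The size condition matters for j = i - 1: past the end [hopH i] is 0 although [hopF j] may not
    be. *)
Lemma hopHF i j x d : (i.+1 < size d)%N ->
  hopH i (hopF j x) d = hopF j (hopH i x) d - (cartanA i j)%:~R * hopF j x d.
Proof.
elim: i j x d => [|i IH] [|j] x d.
- case: d => [|a [|b z]] //= _.
  by case: a => -[] []; case: b => -[] [] /=; rewrite /cartanA /=; ring.
- case: j => [|j].
    case: d => [|a [|b [|c z]]] //= _; first by rewrite !mulr0 subr0.
    by case: a => -[] []; case: b => -[] []; case: c => -[] [] /=; rewrite /cartanA /=; ring.
  rewrite (_ : cartanA 0 j.+2 = 0) // mul0r subr0.
  case: d => [|a [|b z]] //= _.
  by rewrite hopF_scale.
- case: i {IH} => [|i].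
    case: d => [|a [|b [|c z]]] //= _.
    by case: a => -[] []; case: b => -[] []; case: c => -[] [] /=; rewrite /cartanA /=; ring.
  rewrite (_ : cartanA i.+2 0 = 0) // mul0r subr0.
  case: d => [|a [|b z]] //= _.
  by rewrite hopH_lin.
- case: d => [|a z] //= iz.
  by rewrite IH.
Qed.

Lemma hopF_ext k x y d : (forall z, size z = size d -> x z = y z) ->
  hopF k x d = hopF k y d.
Proof.
elim: k x y d => [|k IH] x y [|a z] //= xy.
  by case: z xy => [|b z] //= xy; rewrite !xy.
by apply: IH => u uz; apply: xy; rewrite /= uz.
Qed.

Lemma hopE_ext k x y d : (forall z, size z = size d -> x z = y z) ->
  hopE k x d = hopE k y d.
Proof.
elim: k x y d => [|k IH] x y [|a z] //= xy.
  by case: z xy => [|b z] //= xy; rewrite !xy.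
by apply: IH => u uz; apply: xy; rewrite /= uz.
Qed.

Lemma hopH_ext k x y d : (forall z, size z = size d -> x z = y z) ->
  hopH k x d = hopH k y d.
Proof.
elim: k x y d => [|k IH] x y [|a z] //= xy.
  by case: z xy => [|b z] //= xy; rewrite !xy.
by apply: IH => u uz; apply: xy; rewrite /= uz.
Qed.

Definition sites : seq site := [:: (true, true); (true, false); (false, true); (false, false)].

Fixpoint configs N : seq (seq site) :=
  if N is N'.+1 then [seq a :: z | a <- sites, z <- configs N'] else [:: [::]].

Lemma mem_configs d : d \in configs (size d).
Proof.
elim: d => [//|a d IH]; apply: (@allpairs_f _ _ _ cons) => //.
by case: a => -[] [].
Qed.

Lemma size_configs N d : d \in configs N -> size d = N.
Proof.
elim: N d => [|N IH] d; first by rewrite inE => /eqP ->.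
by case/allpairsP=> -[a z] [_ zN ->] /=; rewrite (IH z).
Qed.

Definition hform N x y : K := \sum_(d <- configs N) x d * (y d)^*.

Lemma hformS N x y :
  hform N.+1 x y = \sum_(a <- sites) hform N (fun z => x (a :: z)) (fun z => y (a :: z)).
Proof. by rewrite /hform big_allpairs_dep. Qed.

(** On two neighbouring sites [hopE] and [hopF] are real matrices, transposes of each other; the
    remaining sites are spectators. *)
Lemma hform_adj N k x y : hform N (hopF k x) y = hform N x (hopE k y).
Proof.
elim: k N x y => [|k IH] N x y; last first.
  case: N => [|N]; first by rewrite /hform !big_seq1 /= conjC0 mul0r mulr0.
  by rewrite !hformS; apply: eq_bigr => a _; rewrite -IH.
case: N => [|[|N]]; first by rewrite /hform !big_seq1 /= conjC0 mul0r mulr0.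
  by rewrite !hformS !big_cons !big_nil /hform !big_seq1 /= !conjC0 !mul0r !mulr0.
have E u w : hform N.+2 u w = \sum_(z <- configs N) \sum_(a <- sites) \sum_(b <- sites)
    u (a :: b :: z) * (w (a :: b :: z))^*.
  rewrite hformS [RHS]exchange_big; apply: eq_bigr => a _.
  by rewrite hformS [RHS]exchange_big; apply: eq_bigr.
rewrite !E; apply: eq_bigr => z _; rewrite /sites !big_cons !big_nil /=.
by rewrite !(mul0r, mul1r, add0r, addr0, conjC0, mulr0, rmorphD) /=; ring.
Qed.

Lemma hform_eq0 N x d : hform N x x = 0 -> size d = N -> x d = 0.
Proof.
move=> /eqP; rewrite psumr_eq0 => [|? _]; last exact: mul_conjC_ge0.
move/allP => al dN; have := al d; rewrite -dN mem_configs => /(_ isT) /=.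
by rewrite mul_conjC_eq0 => /eqP.
Qed.

Lemma hform_linl N a x y u :
  hform N (fun d => a * x d + y d) u = a * hform N x u + hform N y u.
Proof.
rewrite /hform mulr_sumr -big_split; apply: eq_bigr => d _ /=; ring.
Qed.

End TwoColumnModel.

(** * Transfer of linear relations from the module to the model *)

Section Comparison.
Variables (K : numClosedFieldType) (g : lieAlgType K) (V : lmodType K).
Variable rho : lieRep g V.
Variables (m : nat) (e f h : nat -> g) (lam : nat -> int) (v : V).
Variable vac : seq site -> K.
Hypothesis ch : chevalleyA m e f h.
Hypothesis v0 : v != 0.
Hypothesis ev : forall k, (k < m)%N -> rho (e k) v = 0.
Hypothesis hv : forall k, (k < m)%N -> rho (h k) v = (lam k)%:~R *: v.
Hypothesis evac : forall k d, (k < m)%N -> size d = m.+1 -> hopE k vac d = 0.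
Hypothesis hvac : forall k d, (k < m)%N -> size d = m.+1 ->
  hopH k vac d = (lam k)%:~R * vac d.

(* the span of the pairs (f_w v, F_w vac), for the words [w] of length [n] *)
Inductive word_graph : nat -> V -> (seq site -> K) -> Prop :=
| WG0 a : word_graph 0 (a *: v) (fun d => a * vac d)
| WGL n a x y x' y' : word_graph n x y -> word_graph n x' y' ->
    word_graph n (a *: x + x') (fun d => a * y d + 1 * y' d)
| WGF n k x y : (k < m)%N -> word_graph n x y ->
    word_graph n.+1 (rho (f k) x) (hopF k y)
| WGext n x y y' : word_graph n x y -> (forall d, size d = m.+1 -> y d = y' d) ->
    word_graph n x y'.

Lemma word_graphH n x y i : (i < m)%N -> word_graph n x y ->
  word_graph n (rho (h i) x) (hopH i y).
Proof.
move=> im; elim=> {n x y} [a|n a x y x' y' _ IH _ IH'|n k x y km xy IH|n x y y' xy IH yy'].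
- rewrite repZr hv // scalerA; apply: WGext (WG0 _) _ => d dm.
  rewrite hopH_scale hvac //; ring.
- rewrite rep_linr; apply: WGext (WGL a IH IH') _ => d dm.
  by rewrite hopH_lin.
- rewrite rep_comm (chHF ch) // repZl addrC.
  apply: WGext (WGL _ (WGF km xy) (WGF km IH)) _ => d dm.
  by rewrite hopHF ?dm //; ring.
- apply: WGext IH _ => d dm.
  by apply: hopH_ext => z zd; apply: yy'; rewrite zd.
Qed.

Lemma word_graph_zero n x y y0 : word_graph n x y ->
  (forall d, size d = m.+1 -> y0 d = 0) -> word_graph n 0 y0.
Proof.
move=> xy y00; rewrite -(addNr x) -scaleN1r; apply: WGext (WGL (-1) xy xy) _ => d dm.
by rewrite y00 // mulN1r mul1r addNr.
Qed.

(** Both components obey the same commutation relations, so moving the raising operator towards the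
    highest weight vector acts on them in parallel. *)
Lemma word_graphE n x y i : (i < m)%N -> word_graph n x y ->
  if n is n'.+1 then word_graph n' (rho (e i) x) (hopE i y)
  else rho (e i) x = 0 /\ forall d, size d = m.+1 -> hopE i y d = 0.
Proof.
move=> im; elim=> {n x y} [a|n a x y x' y' xy IH xy' IH'|n k x y km xy IH|n x y y' xy IH yy'].
- rewrite repZr ev // scaler0; split=> // d dm.
  by rewrite hopE_scale evac // mulr0.
- case: n xy IH xy' IH' => [|n] _ IH _ IH'; last first.
    rewrite rep_linr; apply: WGext (WGL a IH IH') _ => d dm.
    by rewrite hopE_lin.
  rewrite rep_linr; case: IH IH' => -> IH [-> IH']; rewrite scaler0 addr0.
  by split=> // d dm; rewrite hopE_lin IH // IH' // !mulr0 addr0.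
- have Hx : word_graph n (rho (lie_br (e i) (f k)) x)
      (fun d => if i == k then hopH i y d else 0).
    rewrite (chEF ch) //; case: eqP => _; first exact: word_graphH.
    by rewrite rep0l; apply: word_graph_zero xy _.
  have Fx : word_graph n (rho (f k) (rho (e i) x)) (hopF k (hopE i y)).
    case: n xy IH {Hx} => [|n] xy IH; last exact: WGF.
    case: IH => -> y0; rewrite rep0r; apply: word_graph_zero xy _ => d dm.
    rewrite (@hopF_ext _ _ _ (fun z => 0 * y z)) ?hopF_scale ?mul0r // => z zd.
    by rewrite y0 ?mul0r ?zd.
  rewrite rep_comm -[rho (f k) _]scale1r; apply: WGext (WGL 1 Fx Hx) _ => d dm.
  by rewrite hopEF !mul1r.
- case: n xy IH => [|n] _ IH; first last.
    by apply: WGext IH _ => d dm; apply: hopE_ext => z zd; apply: yy'; rewrite zd.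
  case: IH => e0 y0; split=> // d dm; rewrite -(y0 d) //.
  by apply: hopE_ext => z zd; rewrite yy' // zd.
Qed.

Lemma word_graph0 x y : word_graph 0 x y ->
  exists a, x = a *: v /\ forall d, size d = m.+1 -> y d = a * vac d.
Proof.
move En : 0%N => n wg; elim: wg En => {n x y} //.
- by move=> a _; exists a.
- move=> n a x y x' y' _ IH _ IH' n0; have [b [-> yb]] := IH n0; have [c [-> yc]] := IH' n0.
  exists (a * b + c); rewrite scalerDl scalerA; split=> // d dm.
  by rewrite yb // yc //; ring.
- move=> n x y y' _ IH yy' n0; have [b [-> yb]] := IH n0; exists b; split=> // d dm.
  by rewrite -yy' ?yb.
Qed.

(* The cyclic submodule generated by [vac] has no vector killed by all words
   in the raising operators, because the Hermitian form is positive definite. *)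
Lemma word_graph_eq0 n y d : word_graph n 0 y -> size d = m.+1 -> y d = 0.
Proof.
move=> wg; apply: hform_eq0.
(* By induction on the pair with second component [z]: the adjoint of each lowering operator
   shortens the words behind [u], down to length 0, where [v != 0] forces a zero multiple of
   [vac]. *)
suff H x z : word_graph n x z -> forall u, word_graph n 0 u -> hform m.+1 z u = 0.
  exact: (H 0 y wg y wg).
elim=> {x z y wg} [a|{}n a x y x' y' _ IH _ IH'|{}n k x y km _ IH|{}n x y y' _ IH yy'] u wu.
- have [b [/esym/eqP]] := word_graph0 wu; rewrite scaler_eq0 (negPf v0) orbF => /eqP -> u0.
  by rewrite /hform big_seq big1 // => z zm; rewrite u0 ?mul0r ?conjC0 ?mulr0 // (size_configs zm).
- transitivity (hform m.+1 (fun d => a * y d + y' d) u).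
    by apply: eq_bigr => z _; rewrite mul1r.
  by rewrite hform_linl IH // IH' // mulr0 addr0.
- by rewrite hform_adj; apply: IH; have := word_graphE km wu; rewrite rep0r.
- rewrite -(IH u wu) /hform big_seq [RHS]big_seq; apply: eq_bigr => z zm.
  by rewrite yy' // (size_configs zm).
Qed.

End Comparison.

(** * Independence in the model *)

Section Independence.
Variable K : numClosedFieldType.
Implicit Types (x y : seq site -> K) (d z : seq site).

Definition ket (u : seq site) : seq site -> K := fun d => (d == u)%:R.

Definition tens (a : site) y : seq site -> K :=
  fun d => if d is a' :: z then (a' == a)%:R * y z else 0.

Definition hopFs (w : seq nat) x : seq site -> K := foldr (fun k y => hopF k y) x w.

Lemma hopFs_cat u w x : hopFs (u ++ w) x = hopFs u (hopFs w x).
Proof. exact: foldr_cat. Qed.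

Lemma hopFD k x y : hopF k (fun d => x d + y d) = (fun d => hopF k x d + hopF k y d).
Proof.
apply: funext => d; rewrite -[hopF k x d]mul1r -[hopF k y d]mul1r -hopF_lin.
by congr hopF; apply: funext => z; rewrite !mul1r.
Qed.

Lemma hopFsD w x y : hopFs w (fun d => x d + y d) = (fun d => hopFs w x d + hopFs w y d).
Proof. by elim: w => //= k w ->; rewrite hopFD. Qed.

Lemma ket_cons a u : ket (a :: u) = tens a (ket u).
Proof.
by apply: funext => -[|b z] //=; rewrite /ket eqseq_cons -natrM mulnb.
Qed.

Lemma hopF_tens k a y : hopF k.+1 (tens a y) = tens a (hopF k y).
Proof. by apply: funext => -[|b z] //=; rewrite hopF_scale. Qed.

Lemma hopFs_tens w a y : hopFs (map succn w) (tens a y) = tens a (hopFs w y).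
Proof.
elim: w => // k w IH; rewrite -[LHS]/(hopF k.+1 (hopFs (map succn w) (tens a y))).
by rewrite IH hopF_tens.
Qed.

Lemma tensD a y y' : tens a (fun d => y d + y' d) = (fun d => tens a y d + tens a y' d).
Proof. by apply: funext => -[|b z] /=; rewrite ?mulrDr ?addr0. Qed.

Definition single (c : bool) : site := (c, ~~ c).
Local Notation o := (false, false).
Local Notation D := (true, true).

Lemma hopF_empty_single c z : hopF 0 (ket (o :: single c :: z)) = ket (single c :: o :: z).
Proof.
apply: funext => -[|a [|b u]]; rewrite /ket /= ?eqseq_cons ?andbF //.
by case: a => -[] []; case: b => -[] []; case: c; rewrite /= ?xpair_eqE /=; ring.
Qed.

Lemma hopF_single_double c z :
  hopF 0 (ket (single c :: D :: z)) = ket (D :: single c :: z).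
Proof.
apply: funext => -[|a [|b u]]; rewrite /ket /= ?eqseq_cons ?andbF //.
by case: a => -[] []; case: b => -[] []; case: c; rewrite /= ?xpair_eqE /=; ring.
Qed.

Lemma hopF_empty_double z : hopF 0 (ket (o :: D :: z)) =
  (fun d => ket (single true :: single false :: z) d + ket (single false :: single true :: z) d).
Proof.
apply: funext => -[|a [|b u]]; rewrite /ket /= ?eqseq_cons ?andbF ?addr0 //.
by case: a => -[] []; case: b => -[] []; rewrite /= ?xpair_eqE /=; ring.
Qed.

Lemma hopFs_iotaS p x :
  hopFs (iota 0 p.+1) x = hopF 0 (hopFs (map succn (iota 0 p)) x).
Proof. by rewrite -(iotaDl 1 0 p). Qed.

Lemma hopFs_pop p c z : hopFs (iota 0 p) (ket (nseq p o ++ single c :: z)) =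
  ket (single c :: nseq p o ++ z).
Proof.
elim: p => [//|p IH]; rewrite hopFs_iotaS [in LHS]ket_cons hopFs_tens IH.
by rewrite -ket_cons hopF_empty_single.
Qed.

Lemma hopFs_singles cs z : hopFs (iota 0 (size cs)) (ket (map single cs ++ D :: z)) =
  ket (D :: map single cs ++ z).
Proof.
elim: cs => [//|c cs IH]; rewrite hopFs_iotaS [in LHS]ket_cons hopFs_tens IH.
by rewrite -ket_cons hopF_single_double.
Qed.

(** The double site travels left past the singles, splits in two ways with the last empty site, and
    the left half travels on past the other empty sites. *)
Lemma hopFs_push p cs z :
  hopFs (iota 0 (p.+1 + size cs)) (ket (nseq p.+1 o ++ map single cs ++ D :: z)) =
  (fun d => ket (single true :: nseq p o ++ single false :: map single cs ++ z) d
          + ket (single false :: nseq p o ++ single true :: map single cs ++ z) d).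
Proof.
elim: p => [|p IH]; rewrite hopFs_iotaS [in LHS]ket_cons hopFs_tens.
  by rewrite hopFs_singles -ket_cons hopF_empty_double.
by rewrite IH tensD hopFD -!ket_cons !hopF_empty_single.
Qed.

Definition extremal p q : seq site :=
  nseq p o ++ nseq q (single true) ++ nseq p D.

Lemma hopFs_extremal1 w p q :
  hopFs (map succn w ++ iota 0 p) (ket (extremal p q.+1)) =
  tens (single true) (hopFs w (ket (extremal p q))).
Proof. by rewrite hopFs_cat hopFs_pop ket_cons hopFs_tens. Qed.

Lemma hopFs_extremal2 w p q : exists y,
  hopFs (map succn w ++ iota 0 (p.+1 + q)) (ket (extremal p.+1 q)) =
  (fun d => tens (single true) y d + tens (single false) (hopFs w (ket (extremal p q.+1))) d).
Proof.
have push := hopFs_push p (nseq q true) (nseq p D); rewrite size_nseq map_nseq in push.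
rewrite hopFs_cat [hopFs (iota _ _) _]push hopFsD.
by rewrite ket_cons hopFs_tens ket_cons hopFs_tens; eexists.
Qed.

(* Distinguish the two kinds of words by the first letter: only the words that
   pop a doubly occupied site can produce [single false] there. *)
Lemma ballot_free p q (a : seq nat -> K) :
  (forall d, size d = (2 * p + q)%N ->
     \sum_(w <- ballot_words p q) a w * hopFs w (ket (extremal p q)) d = 0) ->
  forall w, w \in ballot_words p q -> a w = 0.
Proof.
elim: p q a => [|p IHp] q a.
  move=> H w; rewrite inE => /eqP ->.
  have := H (extremal 0 q); rewrite big_seq1 /= /ket eqxx mulr1; apply.
  by rewrite /extremal cats0 size_nseq.
(* Evaluation at configurations that start with [single false] turns a relation among words of the
   second kind into one for the smaller p. *)
have second r (b : seq nat -> K) : (forall z, size z = (2 * p + r.+1)%N ->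
    \sum_(w <- ballot_words p r.+1) b (map succn w ++ iota 0 (p.+1 + r))
      * hopFs (map succn w ++ iota 0 (p.+1 + r)) (ket (extremal p.+1 r)) (single false :: z) = 0) ->
    forall w, w \in ballot_words p r.+1 -> b (map succn w ++ iota 0 (p.+1 + r)) = 0.
  move=> H; apply: (IHp r.+1 (fun w => b (map succn w ++ iota 0 (p.+1 + r)))) => z zs.
  rewrite -[RHS](H z zs); apply: eq_bigr => w _; congr (_ * _).
  by have [y ->] := hopFs_extremal2 w p r; rewrite /= mul0r add0r mul1r.
elim: q a => [|q IHq] a H.
  rewrite ballot_words_S0 => _ /mapP[w win ->]; rewrite -{1}(addn0 p.+1).
  apply: second win => z zs; rewrite -[RHS](H (single false :: z)); last by rewrite /= zs; lia.
  by rewrite ballot_words_S0 big_map addn0.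
have H2 w : w \in ballot_words p q.+2 -> a (map succn w ++ iota 0 (p.+1 + q.+1)) = 0.
  apply: second => z zs; rewrite -[RHS](H (single false :: z)); last by rewrite /= zs; lia.
  rewrite ballot_words_SS big_cat !big_map /= [X in _ = X + _]big1 ?add0r // => u _.
  by rewrite (hopFs_extremal1 u p.+1 q) /= mul0r mulr0.
(* With the second kind gone, evaluation at [single true] isolates the first. *)
have H1 w : w \in ballot_words p.+1 q -> a (map succn w ++ iota 0 p.+1) = 0.
  apply: (IHq (fun w => a (map succn w ++ iota 0 p.+1))) => z zs.
  rewrite -[RHS](H (single true :: z)); last by rewrite /= zs; lia.
  rewrite ballot_words_SS big_cat !big_map /= [X in _ = _ + X]big_seq.
  rewrite [X in _ = _ + X]big1 ?addr0 => [|u uin]; last by rewrite H2 ?mul0r.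
  by apply: eq_bigr => u _; rewrite (hopFs_extremal1 u p.+1 q) /= mul1r.
by move=> w; rewrite ballot_words_SS mem_cat => /orP[] /mapP[u uin ->]; [apply: H1|apply: H2].
Qed.

Lemma hopE_tens k a y : hopE k.+1 (tens a y) = tens a (hopE k y).
Proof. by apply: funext => -[|b z] //=; rewrite hopE_scale. Qed.

Lemma hopH_tens k a y : hopH k.+1 (tens a y) = tens a (hopH k y).
Proof. by apply: funext => -[|b z] //=; rewrite hopH_scale. Qed.

Lemma hopE_ket_nil k d : hopE k (ket [::]) d = 0.
Proof.
elim: k d => [|k IH] [|a z] //=; first by case: z => //= b z; rewrite /ket /= !mulr0 addr0.
have -> : (fun u => ket [::] (a :: u)) = (fun u => 0 * ket [::] u).
  by apply: funext => u; rewrite mul0r.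
by rewrite hopE_scale mul0r.
Qed.

Lemma hopE_empties_doubles k r l d : hopE k (ket (nseq r o ++ nseq l D)) d = 0.
Proof.
elim: r k d => [|r IH] k d; last first.
  case: k => [|k].
    case: d => [|[a1 a2] [|b z]] //=; rewrite /ket !eqseq_cons !xpair_eqE /=.
    by rewrite andbF /= !mulr0 addr0.
  by rewrite ket_cons hopE_tens /tens; case: d => // a z; rewrite IH mulr0.
elim: l k d => [|l IH] k d; first exact: hopE_ket_nil.
case: k => [|k].
  case: d => [|[a1 a2] [|[b1 b2] z]] //=; rewrite /ket !eqseq_cons !xpair_eqE /=.
  by case: l {IH} => [|l]; rewrite ?andbF ?mulr0 ?addr0 //= !eqseq_cons !xpair_eqE /= ?andbF ?mulr0 ?addr0.
by rewrite ket_cons hopE_tens /tens; case: d => // a z; rewrite IH mulr0.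
Qed.

Lemma hopH_empties_doubles k r l d : (k.+1 < r + l)%N ->
  hopH k (ket (nseq r o ++ nseq l D)) d =
  (k.+1 == r)%:R * 2%:R * ket (nseq r o ++ nseq l D) d.
Proof.
elim: k r l d => [|k IH] r l d kl.
  have [x [y [u [-> xy]]]] : exists (x y : site) (u : seq site), nseq r o ++ nseq l D = x :: y :: u /\
      (y.1%:R + y.2%:R - x.1%:R - x.2%:R = (1 == r)%:R * 2%:R :> K).
    case: r kl => [|[|r]] kl.
    - case: l kl => [|[|l]] // _; exists D, D, (nseq l D); split=> //=; ring.
    - case: l kl => [|l] // _; exists o, D, (nseq l D); split=> //=; ring.
    - by exists o, o, (nseq r o ++ nseq l D); split=> //=; ring.
  case: d => [|a [|b z]]; rewrite /ket /= ?eqseq_cons ?andbF ?mulr0 //.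
  by case: (a =P x) => [->|_]; case: (b =P y) => [->|_]; rewrite /= ?mulr0 // xy.
case: r kl => [|r] kl.
  case: l kl => // l kl; rewrite ket_cons hopH_tens /tens; case: d => [|a z]; first by rewrite mulr0.
  by rewrite (IH 0%N l) //=; ring.
rewrite ket_cons hopH_tens /tens; case: d => [|a z]; first by rewrite mulr0.
by rewrite (IH r l) // eqSS; ring.
Qed.

Lemma hopE_extremal k l d : hopE k (ket (extremal l 0)) d = 0.
Proof. exact: hopE_empties_doubles. Qed.

Lemma hopH_extremal k l d : (k.+1 < 2 * l)%N ->
  hopH k (ket (extremal l 0)) d = (two_step l 0 k)%:~R * ket (extremal l 0) d.
Proof.
move=> kl; rewrite hopH_empties_doubles; last by lia.
congr (_ * _); case: l kl => [|l] kl; first by lia.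
rewrite -[two_step _ _ _]/((k.+1 == l.+1)%:Z + (k.+1 == l.+1 + 0)%N%:Z) addn0.
by case: eqP => _ /=; ring.
Qed.

End Independence.

(** * Counting 321-avoiding permutations *)

Section Counting.
Local Open Scope nat_scope.

Lemma size_ballot p q :
  size (ballot_words p.+1 q) = \sum_(j < q.+1) size (ballot_words p j.+1).
Proof.
elim: q => [|q IH]; first by rewrite ballot_words_S0 size_map big_ord1.
by rewrite ballot_words_SS size_cat !size_map IH [RHS]big_ord_recr.
Qed.

Definition increasing_from l (s : 'S_l) (j : nat) : bool :=
  [forall a : 'I_l, forall b : 'I_l, (j <= a < b) ==> (s a < s b)].

Lemma increasing_fromP l (s : 'S_l) j :
  reflect (forall a b : 'I_l, j <= a -> a < b -> s a < s b) (increasing_from s j).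
Proof.
apply: (iffP forallP) => [H a b ja ab|H a].
  by have /forallP/(_ b) := H a; rewrite ja ab.
by apply/forallP => b; apply/implyP => /andP[]; apply: H.
Qed.

Lemma increasing_from_ex l (s : 'S_l) : exists j, increasing_from s j.
Proof. by exists l; apply/increasing_fromP => a b; have := ltn_ord a; lia. Qed.

(** The start of the maximal increasing suffix, whose length is therefore [l - last_descent s]. *)
Definition last_descent l (s : 'S_l) : nat := ex_minn (increasing_from_ex s).

Lemma last_descentE l (s : 'S_l) j : increasing_from s j = (last_descent s <= j).
Proof.
rewrite /last_descent; case: ex_minnP => t /increasing_fromP inct tmin.
apply/idP/idP => [|tj]; first exact: tmin.
by apply/increasing_fromP => a b ja; apply: inct; lia.
Qed.

Lemma last_descent_le l (s : 'S_l) : last_descent s <= l.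
Proof.
by rewrite -last_descentE; apply/increasing_fromP => a b; have := ltn_ord a; lia.
Qed.

Lemma last_descent_uniq l (s : 'S_l) t :
  (forall j, increasing_from s j = (t <= j)) -> last_descent s = t.
Proof.
move=> H; apply/eqP; rewrite eqn_leq -last_descentE H leqnn /=.
by rewrite -H last_descentE.
Qed.

Lemma avoids321P l (w : 'S_l) :
  reflect (forall i j k : 'I_l, i < j -> j < k -> w k < w j -> w j < w i -> False)
          (avoids321 w).
Proof.
apply: (iffP idP) => [H i j k ij jk kj ji|H].
  case/negP: H; apply/existsP; exists i; apply/existsP; exists j; apply/existsP; exists k.
  exact/and4P.
apply/negP => /existsP[i /existsP[j /existsP[k /and4P[ij jk ji kj]]]].
exact: H kj ji.
Qed.

Section InsertMax.
Variables (l : nat) (i : 'I_l.+1) (s : 'S_l).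
Let w : 'S_l.+1 := lift_perm i ord_max s.

Lemma insert_max_at : w i = l :> nat.
Proof. by rewrite /w lift_perm_id. Qed.

Lemma insert_max_lift a : w (lift i a) = s a :> nat.
Proof. by rewrite /w lift_perm_lift lift_max. Qed.

(** The maximum can only play the 3 of a pattern, so the entries after it must contain no
    descent. *)
Lemma avoids321_insert_max : avoids321 w = avoids321 s && increasing_from s i.
Proof.
have lt_lift (a b : 'I_l) : a < b -> lift i a < lift i b.
  by rewrite /= /bump; lia.
have lift_lt (a b : 'I_l) : lift i a < lift i b -> a < b.
  by rewrite /= /bump; lia.
apply/avoids321P/andP => [H|[/avoids321P Hs /increasing_fromP Hi] x y z].
  split; first apply/avoids321P => a b c ab bc cb ba.
    apply: (H (lift i a) (lift i b) (lift i c)); rewrite ?insert_max_lift //; exact: lt_lift.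
  apply/increasing_fromP => a b ia ab; rewrite ltnNge leq_eqVlt; apply/negP => /orP[/eqP|ba].
    by move/val_inj/perm_inj => ba; rewrite ba ltnn in ab.
  apply: (H i (lift i a) (lift i b)); rewrite ?insert_max_at ?insert_max_lift //.
  - by rewrite /= /bump; lia.
  - exact: lt_lift.
have wle (t : 'I_l.+1) : w t <= l by rewrite -ltnS.
case: (unliftP i y) => [b ->|->]; last first.
  by move=> _ _ _; rewrite insert_max_at ltnNge wle.
case: (unliftP i z) => [c ->|->]; last first.
  by move=> _ _; rewrite insert_max_at insert_max_lift; have := ltn_ord (s b); lia.
move=> xy /lift_lt bc; rewrite !insert_max_lift => cb.
case: (unliftP i x) xy => [a ->|->] xy.
  by rewrite insert_max_lift => ba; apply: (Hs a b c) => //; apply: lift_lt.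
move=> _; have := Hi b c; rewrite bc => /(_ _ isT); move: xy; rewrite /= /bump; lia.
Qed.

(** Appended at the end, the maximum prolongs the increasing suffix; anywhere else it creates a
    descent, and the suffix starts right after it. *)
Lemma last_descent_insert_max : increasing_from s i ->
  last_descent w = if i == l :> nat then last_descent s else i.+1.
Proof.
move=> /increasing_fromP Hi; apply: last_descent_uniq => j.
have wi := insert_max_at; have wl := insert_max_lift.
case: eqP => il.
  rewrite -last_descentE; apply/increasing_fromP/increasing_fromP => H a b ja ab.
    by rewrite -!wl; apply: H; rewrite /= /bump il; have := ltn_ord a; have := ltn_ord b; lia.
  have al : a < l by have := ltn_ord b; lia.
  case: (unliftP i a) al ja ab => [a' ->|->] al ja ab; last by lia.
  case: (unliftP i b) ab => [b' ->|->] ab; last by rewrite wi wl.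
  rewrite !wl; apply: H; move: ja ab al; rewrite /= /bump il; have := ltn_ord a'; have := ltn_ord b'; lia.
have {}il : i < l by have := ltn_ord i; lia.
apply/increasing_fromP/idP => [H|ij a b ja ab].
  rewrite ltnNge; apply/negP => ji.
  have := H i (lift i (Ordinal il)) ji; rewrite wi wl /= /bump leqnn.
  by have := ltn_ord (s (Ordinal il)); lia.
case: (unliftP i a) ja ab => [a' ->|->] ja ab; last by lia.
case: (unliftP i b) ab => [b' ->|->] ab; last by move: ja ab; rewrite /= /bump; lia.
by rewrite !wl; apply: Hi; move: ja ab; rewrite /= /bump; lia.
Qed.

End InsertMax.

Lemma insert_max_bij l :
  bijective (fun u : 'S_l * 'I_l.+1 => lift_perm u.2 ord_max u.1).
Proof.
apply: inj_card_bij; last by rewrite card_prod card_ord !card_Sn factS mulnC.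
move=> [s i] [t j] /= E.
have ij : i = j.
  apply: (@perm_inj _ (lift_perm j ord_max t)).
  by rewrite -{1}E !lift_perm_id.
rewrite -{}ij in E *; congr pair; apply/permP => a.
have := congr1 (fun u : 'S_l.+1 => u (lift i a)) E.
by rewrite !lift_perm_lift => /lift_inj.
Qed.

(** The sites i in [t, l) give the suffix lengths l - i, and the site l gives l + 1 - t. *)
Lemma sum_insert_sites (F : nat -> nat) l t : t <= l ->
  \sum_(i < l.+1 | t <= i) F (l.+1 - (if i == l :> nat then t else i.+1))
  = \sum_(j < (l - t).+1) F j.+1.
Proof.
move=> tl; rewrite big_mkcond big_ord_recr /= tl eqxx [RHS]big_ord_recr /= subSn //.
congr (_ + _); rewrite -big_mkcond /=.
rewrite -(big_geq_mkord t l xpredT (fun i => F (l.+1 - (if i == l then t else i.+1)))).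
rewrite -[t in LHS]add0n big_addn big_nat_rev /= big_mkord; apply: eq_bigr => -[j jl] _ /=.
by congr F; case: eqP; lia.
Qed.

(* Generating tree: inserting the maximum into a 321-avoiding permutation whose
   maximal increasing suffix has length [k] produces children with suffix
   lengths 1, ..., k + 1; the same recursion rules [size_ballot]. *)
Lemma count_avoids321 l r :
  \sum_(w : 'S_l | avoids321 w) size (ballot_words r (l - last_descent w))
  = size (ballot_words (l + r) 0).
Proof.
elim: l r => [|l IH] r.
  have av (w : 'S_0) : avoids321 w by apply/avoids321P => -[].
  under eq_bigl do rewrite av.
  have -> : \sum_(w : 'S_0) size (ballot_words r (0 - last_descent w))
          = \sum_(w : 'S_0) size (ballot_words r 0) by apply: eq_bigr => w _; rewrite sub0n.
  by rewrite sum_nat_const card_Sn mul1n.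
(* [r] counts the levels of the tree still to come: one insertion turns (l + 1, r) into (l, r +
   1). *)
rewrite addSnnS -IH; have [g fg gf] := insert_max_bij l.
rewrite (reindex (fun u : 'S_l * 'I_l.+1 => lift_perm u.2 ord_max u.1)); last first.
  by exists g => u _; [apply: fg|apply: gf].
pose F (s : 'S_l) (i : 'I_l.+1) :=
  size (ballot_words r (l.+1 - last_descent (lift_perm i ord_max s))).
under eq_bigl => u do rewrite avoids321_insert_max.
rewrite -(pair_big_dep (fun s : 'S_l => avoids321 s) (fun (s : 'S_l) (i : 'I_l.+1) => increasing_from s i) F) /=.
apply: eq_bigr => s _.
rewrite size_ballot -(sum_insert_sites (fun j => size (ballot_words r j)) (last_descent_le s)).
under eq_bigl => i do rewrite last_descentE.
apply: eq_bigr => i; rewrite -last_descentE /F => inc.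
by rewrite last_descent_insert_max.
Qed.

Lemma card_avoids321 l : #|[set w : 'S_l | avoids321 w]| = size (ballot_words l 0).
Proof.
rewrite -[l in RHS]addn0 -(count_avoids321 l 0) cardsE -sum1_card.
by apply: eq_bigr.
Qed.

End Counting.

(** * Weights and simple roots *)

Section Weights.
Variables (K : numClosedFieldType) (n : nat).
Local Notation alpha i := (simple_root K n i).

Lemma wt_valE (lam : weight K n) h : wt_val lam h = \sum_k lam 0 k * h k 0.
Proof. by rewrite /wt_val mxE. Qed.

Lemma wt_valB (lam mu : weight K n) h : wt_val (lam - mu) h = wt_val lam h - wt_val mu h.
Proof. by rewrite /wt_val mulmxBl !mxE. Qed.

Lemma wt_val_delta (lam : weight K n) k : wt_val lam (delta_mx k 0) = lam 0 k.
Proof.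
rewrite wt_valE (bigD1 k) //= !mxE !eqxx mulr1 big1 ?addr0 // => j jk.
by rewrite !mxE (negPf jk) mulr0.
Qed.

Lemma coroot_delta (i : 'I_n) : coroot K n i = delta_mx (widen_ord (leqnSn n) i) 0.
Proof. by apply/matrixP => k j; rewrite !mxE ord1 eqxx andbT. Qed.

Lemma wt_val_coroot (lam : weight K n) (i : 'I_n) :
  wt_val lam (coroot K n i) = lam 0 (widen_ord (leqnSn n) i).
Proof. by rewrite coroot_delta wt_val_delta. Qed.

Lemma wt_val_simple_root (i j : 'I_n) :
  wt_val (alpha j) (coroot K n i) = (cartan n i j)%:~R.
Proof. by rewrite wt_val_coroot mxE /= ltn_ord. Qed.

Lemma weight_sep (lam mu : weight K n) : lam != mu -> exists h, wt_val lam h != wt_val mu h.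
Proof.
move=> ne; have /existsP[k kne] : [exists k, lam 0 k != mu 0 k].
  apply: contraR ne => /existsPn eqk; apply/eqP/matrixP => i k.
  by rewrite ord1; apply/eqP; have := eqk k; rewrite negbK.
by exists (delta_mx k 0); rewrite !wt_val_delta.
Qed.

Lemma cartan_row k (i : 'I_n) : (0 < k < n)%N ->
  cartan n k i = 2 * (i == k :> nat)%:Z - (i == k.-1 :> nat)%:Z - (i == (k.+1 %% n)%N :> nat)%:Z.
Proof.
case/andP=> k0 kn; rewrite /cartan [k == i :> nat]eq_sym; congr (_ - _%:Z - _%:Z).
  have := ltn_ord i; rewrite leq_eqVlt => /orP[/eqP iln|iln].
    by rewrite iln modnn modn_small; lia.
  by rewrite !modn_small //; lia.
by rewrite (modn_small (ltn_ord i)).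
Qed.

(** The value on [d] fixes the multiplicity of alpha_0. Rows 1, ..., n - 1 of the Cartan matrix then
    make the difference of the multiplicities an arithmetic progression starting at 0, and closing
    the cycle gives n * d 1 = 0. *)
Lemma simple_root_free (u w : seq 'I_n) : (1 < n)%N ->
  \sum_(i <- u) alpha i = \sum_(i <- w) alpha i -> perm_eq u w.
Proof.
move=> n1 E.
pose c (s : seq 'I_n) (k : nat) : int := \sum_(i <- s) (i == k :> nat)%:Z.
have cE s (i : 'I_n) : c s i = (count_mem i s)%:Z.
  rewrite /c; elim: s => [|j s IH]; first by rewrite big_nil.
  by rewrite big_cons IH /= PoszD.
have coord (s : seq 'I_n) (k : 'I_n.+1) : (\sum_(i <- s) alpha i) 0 k =
    \sum_(i <- s) (if (k < n)%N then (cartan n k i)%:~R else (i == 0%N :> nat)%:R).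
  rewrite summxE; apply: eq_bigr => i _; rewrite mxE //.
have row (s : seq 'I_n) k : (0 < k < n)%N ->
    \sum_(i <- s) cartan n k i = 2 * c s k - c s k.-1 - c s (k.+1 %% n)%N.
  move=> kn; rewrite /c mulr_sumr -!sumrB; apply: eq_bigr => i _.
  by rewrite cartan_row.
pose d k := c u k - c w k.
have d0 : d 0%N = 0.
  have := congr1 (fun M : 'rV[K]_n.+1 => M 0 ord_max) E; rewrite !coord /= ltnn => H.
  have cst (s : seq 'I_n) : \sum_(i <- s) ((i : 'I_n) == 0%N :> nat)%:R = (c s 0%N)%:~R :> K.
    by rewrite /c rmorph_sum /=; apply: eq_bigr => i _; case: eqP.
  by move: H; rewrite !cst => /intr_inj; rewrite /d => ->; rewrite subrr.
have drow k : (0 < k < n)%N -> 2 * d k - d k.-1 - d (k.+1 %% n)%N = 0.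
  move=> kn; have kn1 : (k < n.+1)%N by lia.
  have kn2 : (k < n)%N by lia.
  have := congr1 (fun M : 'rV[K]_n.+1 => M 0 (Ordinal kn1)) E; rewrite !coord /= kn2.
  rewrite -!(rmorph_sum (intmul 1)) /= => /intr_inj; rewrite !row // /d; lia.
have dk k : (k < n)%N -> d k = k%:Z * d 1%N.
  elim/ltn_ind: k => -[|[|k]] IH kn; rewrite ?mul0r ?mul1r //.
  have := drow k.+1; rewrite modn_small //= => /(_ (ltnW kn)).
  by rewrite IH ?(IH k) //; lia.
have d1 : d 1%N = 0.
  have := drow n.-1; rewrite prednK ?modnn ?d0 ?subr0; last by lia.
  rewrite (dk n.-1) ?(dk n.-1.-1); try lia.
  move=> H; have : n%:Z * d 1%N = 0.
    rewrite -H; last by lia.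
    have -> : n.-1.-1%:Z = n%:Z - 2 by lia.
    have -> : n.-1%:Z = n%:Z - 1 by lia.
    ring.
  by move/eqP; rewrite mulf_eq0 => /orP[/eqP n0|/eqP //]; lia.
apply/allP => i _ /=; apply/eqP; have := dk i (ltn_ord i).
by rewrite d1 mulr0 /d !cE => /eqP; rewrite subr_eq0 => /eqP[].
Qed.

End Weights.

(** * Highest weight modules *)

Section KacMoodyRelations.
Variables (K : numClosedFieldType) (n : nat).
Local Notation e := (@km_e K n).
Local Notation f := (@km_f K n).
Local Notation h := (@km_h K n).
Local Notation alpha i := (simple_root K n i).

Lemma lie_class_rel s t : km_rel s t -> lie_class (@km_rel K n) s = lie_class (@km_rel K n) t.
Proof. by move=> st; apply/lie_classP/LErel. Qed.

Lemma km_hf x i : lie_br (h x) (f i) = - wt_val (alpha i) x *: f i.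
Proof. by rewrite lie_class_br (lie_class_rel (KM_HF _ _)) lie_classZ. Qed.

Lemma km_ef i j : lie_br (e i) (f j) = if i == j then h (coroot K n i) else 0.
Proof. by rewrite lie_class_br (lie_class_rel (KM_EF _ _ _)); case: eqP. Qed.

Lemma km_serre (i j : 'I_n) : i != j -> iter `|1 - cartan n i j|%N (lie_br (f i)) (f j) = 0.
Proof.
move=> ij; rewrite -[RHS]/(lie_class (@km_rel K n) LZero) -(lie_class_rel (KM_serreF K ij)).
by elim: `|_|%N => //= k ->; rewrite lie_class_br.
Qed.

End KacMoodyRelations.

Section HighestWeight.
Variables (K : numClosedFieldType) (n : nat).
Variables (V : lmodType K) (rho : lieRep (affine_sl K n) V).
Local Notation e := (@km_e K n).
Local Notation f := (@km_f K n).
Local Notation h := (@km_h K n).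
Local Notation alpha i := (simple_root K n i).

Lemma submodule_gen (W : set V) : W 0 ->
  (forall (a : K) v w, W v -> W w -> W (a *: v + w)) ->
  (forall i v, W v -> W (rho (e i) v)) -> (forall i v, W v -> W (rho (f i) v)) ->
  (forall x v, W v -> W (rho (h x) v)) -> submodule rho W.
Proof.
move=> W0 WL We Wf Wh; split=> //.
have WZ a v : W v -> W (a *: v) by move=> Wv; rewrite -[_ *: _]addr0; apply: WL.
have WD v w : W v -> W w -> W (v + w) by move=> Wv Ww; rewrite -[v]scale1r; apply: WL.
elim/lie_pres_ind; elim=> [[i|i|x]||s IHs t IHt|a s IHs|s IHs t IHt] v Wv.
- exact: We.
- exact: Wf.
- exact: Wh.
- by rewrite rep0l.
- by rewrite -lie_classD -[lie_class _ s]scale1r rep_linl scale1r; apply: WD; [apply: IHs|apply: IHt].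
- by rewrite -lie_classZ repZl; apply/WZ/IHs.
- rewrite -lie_class_br rep_br; apply: WD; first by apply/IHs/IHt.
  by rewrite -scaleN1r; apply/WZ/IHt/IHs.
Qed.

Lemma weight_space_f mu (i : 'I_n) v : weight_space rho mu v -> weight_space rho (mu - alpha i) (rho (f i) v).
Proof.
by move=> mv x; rewrite rep_comm km_hf mv repZr repZl wt_valB -scalerDl.
Qed.

Definition fword (u : seq 'I_n) (v : V) : V := foldr (fun i x => rho (f i) x) v u.

Lemma weight_space_fword mu (u : seq 'I_n) v : weight_space rho mu v ->
  weight_space rho (mu - \sum_(i <- u) alpha i) (fword u v).
Proof.
move=> mv; elim: u => [|i u IH] /=; first by rewrite big_nil subr0.
by rewrite big_cons opprD addrCA addrC; apply: weight_space_f.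
Qed.

(** The span of the words is a submodule: commuting a raising operator to [v] leaves only Cartan
    terms, which act on words by scalars. *)
Lemma hw_fword_span Lam v : weight_space rho Lam v -> (forall i, rho (e i) v = 0) ->
  (forall W : set V, submodule rho W -> W v -> W = setT) ->
  forall x, lspan (fun y => exists u, y = fword u v) x.
Proof.
move=> Lv ev gen x; pose P : set V := lspan (fun y => exists u, y = fword u v).
suff PT : P = setT by have : P x by rewrite PT.
have Pf i y : P y -> P (rho (f i) y).
  elim=> [|a z t [u ->] _ IH]; first by rewrite rep0r; apply: lspan0.
  by rewrite rep_linr; apply: lspanL => //; exists (i :: u).
have Ph k y : P y -> P (rho (h k) y).
  elim=> [|a z t [u ->] _ IH]; first by rewrite rep0r; apply: lspan0.
  rewrite rep_linr (weight_space_fword u Lv) scalerA; apply: lspanL => //.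
  by exists u.
have Pe i y : P y -> P (rho (e i) y).
  elim=> [|a z t [u ->] _ IH]; first by rewrite rep0r; apply: lspan0.
  rewrite rep_linr; apply: lspan_lin IH; elim: u => [|j u IH] /=.
    by rewrite ev; apply: lspan0.
  rewrite rep_comm km_ef -[rho (f j) _]scale1r; apply: lspan_lin; first exact: Pf.
  case: eqP => _; last by rewrite rep0l; apply: lspan0.
  by apply: Ph; apply: lspan_gen; exists u.
apply: gen; last by apply: lspan_gen; exists [::].
by apply: submodule_gen => //; [apply: lspan0|move=> *; apply: lspan_lin].
Qed.

(** A finite list of weights other than mu occurs in [x]; they are removed one at a time. *)
Lemma weight_projection (G : weight K n -> V -> Prop) mu x :
  (forall nu y, G nu y -> weight_space rho nu y) -> weight_space rho mu x ->
  lspan (fun y => exists nu, G nu y) x -> lspan (G mu) x.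
Proof.
move=> Gw mx spx.
have [M] : exists M : seq (weight K n), lspan (fun y => exists2 nu, nu \in mu :: M & G nu y) x.
  elim: spx => [|a y z [nu Gy] _ [M spz]]; first by exists [::]; apply: lspan0.
  exists (nu :: M); apply: lspanL; first by exists nu; rewrite // !inE eqxx orbT.
  apply: lspan_sub spz; first exact: lspan0.
    by move=> *; apply: lspan_lin.
  by move=> t [xi xiM Gt]; apply: lspan_gen; exists xi => //; rewrite !inE in xiM *; case/orP: xiM => ->; rewrite ?orbT.
elim: M => [|nu M IH].
  apply: lspan_sub; [exact: lspan0|by move=> *; apply: lspan_lin|].
  by move=> y [xi]; rewrite inE => /eqP -> Gy; apply: lspan_gen.
move=> sp; apply: IH.
have [E|/weight_sep [k numu]] := eqVneq nu mu.
  subst nu.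
  apply: lspan_sub sp; [exact: lspan0|by move=> *; apply: lspan_lin|].
  by move=> y [xi]; rewrite !inE orbA orbb => xiM Gy; apply: lspan_gen; exists xi; rewrite ?inE.
set b := wt_val mu k; set c := wt_val nu k in numu *.
have bc : b - c != 0 by rewrite subr_eq0 eq_sym.
(* [T] fixes the weight mu, kills the weight nu and acts by a scalar on every other weight. *)
pose T y := (b - c)^-1 *: (rho (h k) y - c *: y).
have -> : x = T x by rewrite /T mx -scalerBl scalerA mulVf // scale1r.
have TL a y z : T (a *: y + z) = a *: T y + T z.
  rewrite /T rep_linr scalerA [in RHS]mulrC -scalerA -scalerDr; congr (_ *: _).
  by rewrite scalerBr scalerDr opprD addrACA !scalerA [c * a]mulrC.
elim: sp => [|a y z [xi xiM Gy] _ IH].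
  by rewrite /T rep0r scaler0 subr0 scaler0; apply: lspan0.
rewrite TL; apply: lspan_lin => //.
rewrite /T (Gw xi y Gy) -scalerBl scalerA.
rewrite -[_ *: y]addr0; case/predU1P: xiM => [xiE|].
  by apply: lspanL (lspan0 _); exists mu; rewrite ?mem_head // -xiE.
case/predU1P => [->|xiM]; first by rewrite subrr mulr0 scale0r addr0; apply: lspan0.
by apply: lspanL (lspan0 _); exists xi => //; rewrite inE; apply/orP; right.
Qed.


Lemma weight_space_span Lam v mu x : weight_space rho Lam v ->
  (forall i, rho (e i) v = 0) ->
  (forall W : set V, submodule rho W -> W v -> W = setT) ->
  weight_space rho mu x ->
  lspan (fun y => exists2 u : seq 'I_n, Lam - \sum_(i <- u) alpha i = mu & y = fword u v) x.
Proof.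
move=> Lv ev gen mx.
apply: (@weight_projection (fun nu y =>
    exists2 u : seq 'I_n, Lam - \sum_(i <- u) alpha i = nu & y = fword u v)) => //.
  by move=> nu y [u <- ->]; apply: weight_space_fword.
apply: lspan_sub (hw_fword_span Lv ev gen x); first exact: lspan0.
  by move=> *; apply: lspan_lin.
by move=> y [u ->]; apply: lspan_gen; exists (Lam - \sum_(i <- u) alpha i), u.
Qed.

End HighestWeight.

(** * The window of the affine diagram *)

Lemma ballot_uniq p q : uniq (ballot_words p q).
Proof.
have inj r : injective (fun w => map succn w ++ iota 0 r).
  move=> u w E; have /eqP := congr1 size E.
  rewrite !size_cat !size_map eqn_add2r => /eqP su.
  move/eqP: E; rewrite eqseq_cat ?size_map // => /andP[/eqP E _].
  exact: (inj_map succn_inj E).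
elim: p q => [//|p IHp]; elim=> [|q IHq].
  by rewrite ballot_words_S0 (map_inj_uniq (inj _)).
have last_iota r x : last x (iota 0 r.+1) = r by rewrite -addn1 iotaD last_cat.
rewrite ballot_words_SS cat_uniq; apply/and3P; split; rewrite ?(map_inj_uniq (inj _)) //.
(* The two kinds of words end in different letters, p and p + q + 1. *)
apply/hasPn => _ /mapP[u _ ->]; apply/mapP => -[w _] /(congr1 (last 0%N)).
by rewrite !last_cat addSn !last_iota; lia.
Qed.

Section Window.
Variables (n l : nat).
Hypothesis hn : (0 < n)%N.

(* Nodes -l, ..., 0, ..., l of the cyclic diagram, relabelled 0, ..., 2l; this [l]
   is one less than that of the theorem. *)
Definition node (k : nat) : 'I_n := Ordinal (ltn_pmod (k + (n - l)) hn).
Definition node_inv (i : 'I_n) : nat := ((i + l) %% n)%N.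

Arguments node : simpl never.

Lemma node_val k : node k = ((k + (n - l)) %% n)%N :> nat.
Proof. by []. Qed.

Hypothesis ln : (2 * l.+1 <= n)%N.

Lemma nodeK k : (k < n)%N -> node_inv (node k) = k.
Proof.
move=> kn; rewrite /node_inv node_val modnDml -addnA subnK; last by lia.
by rewrite modnDr modn_small.
Qed.

Lemma node_invK i : node (node_inv i) = i.
Proof.
apply: val_inj; rewrite [LHS]node_val /node_inv modnDml -addnA subnKC; last by lia.
by rewrite modnDr modn_small.
Qed.

Lemma node_eq j k : (j < n)%N -> (k < n)%N -> (node j == node k) = (j == k).
Proof.
move=> jn kn; apply/eqP/eqP => [|-> //].
by move/(congr1 node_inv); rewrite !nodeK.
Qed.

Lemma node_lo k : (k < l)%N -> node k = (n - (l - k))%N :> nat.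
Proof. by move=> kl; rewrite node_val modn_small; lia. Qed.

Lemma node_hi k : (l <= k < n)%N -> node k = (k - l)%N :> nat.
Proof.
move=> kl; rewrite node_val (_ : k + (n - l) = (k - l) + n)%N; last by lia.
by rewrite modnDr modn_small; lia.
Qed.

Lemma cartan_node j k : (j < n)%N -> (k < n)%N ->
  cartan n (node j) (node k) = 2 * (j == k)%:Z - (j == k.+1 %[mod n])%:Z - (k == j.+1 %[mod n])%:Z.
Proof.
move=> jn kn; rewrite /cartan (inj_eq val_inj) node_eq //; congr (_ - _%:Z - _%:Z).
  by rewrite !node_val modn_mod -[in LHS]addn1 modnDml addnAC eqn_modDr addn1.
by rewrite !node_val modn_mod -[in LHS]addn1 modnDml addnAC eqn_modDr addn1.
Qed.

Lemma cartan_node_window j k : (j.+1 < n)%N -> (k.+1 < n)%N ->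
  cartan n (node j) (node k) = cartanA j k.
Proof.
by move=> jn kn; rewrite cartan_node ?(ltnW jn) ?(ltnW kn) // !modn_small // ltnW.
Qed.

(** The 2l + 1 nodes omit at least one node of the cycle, so adjacency among them is linear. *)
Lemma chevalley_window (K : numClosedFieldType) : chevalleyA (2 * l).+1
  (fun k => km_e K (node k)) (fun k => km_f K (node k))
  (fun k => km_h (coroot K n (node k))).
Proof.
split=> [i j im jm|i j im jm|i j im jm ij|i im|i im].
- by rewrite km_ef node_eq //; lia.
- by rewrite km_hf wt_val_simple_root cartan_node_window //; lia.
- have ne : node i != node j by rewrite node_eq; lia.
  have := km_serre K ne; rewrite cartan_node_window; try lia.
  by rewrite (_ : cartanA i j = 0) // /cartanA; lia.
- have ne : node i != node i.+1 by rewrite node_eq; lia.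
  have := km_serre K ne; rewrite cartan_node_window; try lia.
  by rewrite (_ : cartanA i i.+1 = -1) // /cartanA; lia.
- have ne : node i.+1 != node i by rewrite node_eq; lia.
  have := km_serre K ne; rewrite cartan_node_window; try lia.
  by rewrite (_ : cartanA i.+1 i = -1) // /cartanA; lia.
Qed.

Lemma sum_seq_count (M : nmodType) (F : nat -> M) m w : all (fun k => k < m)%N w ->
  \sum_(k <- w) F k = \sum_(0 <= k < m) F k *+ count_mem k w.
Proof.
elim: w => [|a w IH] /=; first by rewrite big_nil big1.
case/andP=> am wm; rewrite big_cons IH //.
under [RHS]eq_bigr do rewrite mulrnDr.
rewrite big_split /=; congr (_ + _).
rewrite big_mkord (bigD1 (Ordinal am)) //= eqxx big1 ?addr0 // => k ka.
by rewrite (_ : (a == k) = false) // eq_sym; apply: contraNF ka => /eqP ka; apply/eqP/val_inj.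
Qed.

(** The tent of [count_ballot] is centred at k = l, which is the node 0; its left half gives the
    alpha_(n-i) and its right half the alpha_i. *)
Lemma gamma_node (K : numClosedFieldType) w : w \in ballot_words l.+1 0 ->
  gamma_wt K n l.+1 = \sum_(k <- w) simple_root K n (node k).
Proof.
move=> win; have [F FE] : exists F : nat -> weight K n,
    forall k, F k = simple_root K n (node k) by exists (fun k => simple_root K n (node k)).
have Flo k : (k < l)%N -> F k = simple_root K n (n - (l - k)) by move=> kl; rewrite FE node_lo.
have Fhi k : (l <= k < n)%N -> F k = simple_root K n (k - l) by move=> kl; rewrite FE node_hi.
under eq_bigr => k _ do rewrite -FE.
rewrite (sum_seq_count F (ballot_lt win)).
under eq_bigr => k _ do rewrite (count_ballot k win).
rewrite (_ : (2 * l.+1 + 0).-1 = l + l.+1)%N; last by lia.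
rewrite (@big_cat_nat _ _ _ l) //=; last by lia.
rewrite [X in _ + X]big_ltn; last by lia.
rewrite Fhi ?subnn; last by lia.
rewrite /gamma_wt addrCA scaler_nat; congr (_ + _); first by congr (_ *+ _); lia.
rewrite [in LHS]big_add1 /=.
under eq_bigr => k _ do rewrite scalerDr.
symmetry; rewrite big_split /= [RHS]addrC; congr (_ + _).
  rewrite [LHS]big_nat_rev /= !big_mkord; apply: eq_bigr => -[k kl] _ /=.
  rewrite Flo; last by lia.
  rewrite scaler_nat (_ : n - (l - (0 + l - k.+1)) = n - k.+1)%N; last by lia.
  by congr (_ *+ _); lia.
rewrite -[l.+1 in LHS]add0n big_addn (_ : l + l.+1 - l.+1 = l)%N; last by lia.
rewrite !big_mkord; apply: eq_bigr => -[k kl] _ /=.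
rewrite Fhi; last by lia.
rewrite scaler_nat (_ : k + l.+1 - l = k.+1)%N; last by lia.
by congr (_ *+ _); lia.
Qed.

End Window.

(** * The maximal dominant weight *)

Section MaximalWeight.
Variables (K : numClosedFieldType) (n l : nat).
Hypothesis hn : (0 < n)%N.
Hypothesis ln : (2 * l.+1 <= n)%N.
Local Notation alpha i := (simple_root K n i).
Local Notation node := (node l hn).
Local Notation m := (2 * l).+1.
Let Lam : weight K n := 2%:R *: fund_weight K n 0.
Let mu := Lam - gamma_wt K n l.+1.
Let words := ballot_words l.+1 0.

Lemma ballot_word_exists : exists w, w \in words.
Proof.
have := ballot_words_neq0 l.+1 0; rewrite -/words.
by case: words => // w s _; exists w; rewrite mem_head.
Qed.

Lemma words_lt w : w \in words -> all (fun k => k < m)%N w.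
Proof. by move/ballot_lt; apply: sub_all => k; lia. Qed.

Lemma node_map_inj (u w : seq nat) : all (fun k => k < m)%N u -> all (fun k => k < m)%N w ->
  perm_eq (map node u) (map node w) -> perm_eq u w.
Proof.
have idm s : all (fun k => k < m)%N s -> map (node_inv l) (map node s) = s.
  move=> /allP sm; rewrite -map_comp -[RHS]map_id; apply/eq_in_map => k /sm km /=.
  by rewrite nodeK //; lia.
by move=> um wm /(perm_map (node_inv l)); rewrite !idm.
Qed.

Lemma wt_Lam (i : 'I_n) : wt_val Lam (coroot K n i) = (2 * (i == 0%N :> nat)%:Z)%:~R.
Proof. by rewrite wt_val_coroot !mxE /= rmorphM /= -pmulrn; case: eqP. Qed.

Lemma node0 k : (k < n)%N -> (node k == 0%N :> nat) = (k == l).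
Proof.
move=> kn; have <- : node l = 0%N :> nat by rewrite node_hi ?subnn //; lia.
by rewrite (inj_eq val_inj) node_eq //; lia.
Qed.

Lemma wt_Lam_node k : (k < m)%N ->
  wt_val Lam (coroot K n (node k)) = (two_step l.+1 0 k)%:~R.
Proof.
move=> km; rewrite wt_Lam node0; last by lia.
by rewrite -[two_step _ _ _]/((k.+1 == l.+1)%:Z + (k.+1 == l.+1 + 0)%N%:Z) addn0; congr (_%:~R); lia.
Qed.

Lemma mu_word w : w \in words -> mu = Lam - \sum_(i <- map node w) alpha i.
Proof. by move=> win; rewrite /mu (gamma_node hn ln K win) big_map. Qed.

Lemma sum_cartanA_count k w : \sum_(j <- w) cartanA k j =
  2 * (count_mem k w)%:Z - (if k is k'.+1 then (count_mem k' w)%:Z else 0)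
  - (count_mem k.+1 w)%:Z.
Proof.
elim: w => [|j w IH]; first by rewrite big_nil; case: k.
by rewrite big_cons IH /cartanA; case: k {IH} => [|k] /=; lia.
Qed.

(** Inside the window the second difference of the tent cancels 2 Lambda_0. Outside it the node does
    not occur in the word, so only off-diagonal Cartan entries contribute, and these are at most
    0. *)
Lemma mu_dominant : dominant mu.
Proof.
move=> i; have [w win] := ballot_word_exists.
have <- : node (node_inv l i) = i by rewrite node_invK.
have kn : (node_inv l i < n)%N by rewrite /node_inv ltn_pmod.
move: (node_inv l i) kn => k kn {i}.
have wlt j : j \in w -> (j < m)%N by move/(allP (words_lt win)).
have E : wt_val mu (coroot K n (node k)) =
    (2 * (k == l)%:Z - \sum_(j <- w) cartan n (node k) (node j))%:~R.
  rewrite (mu_word win) wt_valB wt_Lam node0 // rmorphB; congr (_ - _).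
  rewrite wt_val_coroot summxE big_map rmorph_sum; apply: eq_bigr => j _.
  by rewrite mxE ifT //; apply: (ltn_ord (node k)).
rewrite E; have [km|mk] := ltnP k m.
  exists 0%N; rewrite (_ : _ - _ = 0) //.
  rewrite big_seq (eq_bigr (cartanA k)) => [|j /wlt jm]; last first.
    by rewrite cartan_node_window //; lia.
  rewrite -big_seq sum_cartanA_count !(count_ballot _ win).
  by case: k km {kn E} => [|k] km; rewrite ?(count_ballot _ win); lia.
pose N := (\sum_(j <- w) ((k == j.+1 %[mod n]) + (j == k.+1 %[mod n])))%N.
exists N; rewrite -[N%:R]/(N%:Z%:~R); congr (_%:~R).
have -> : N%:Z = \sum_(j <- w) ((k == j.+1 %[mod n]) + (j == k.+1 %[mod n]))%N%:Z.
  exact: (big_morph Posz PoszD erefl).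
rewrite (_ : (k == l) = false) ?mulr0 ?sub0r; last by lia.
rewrite -sumrN big_seq [RHS]big_seq; apply: eq_bigr => j /wlt jm.
rewrite cartan_node //; last by lia.
by rewrite (_ : (k == j) = false); lia.
Qed.

(** * A basis of the weight space *)

Variables (V : lmodType K) (rho : lieRep (affine_sl K n) V) (v : V).
Hypothesis v0 : v != 0.
Hypothesis Lv : weight_space rho Lam v.
Hypothesis ev : forall i, rho (km_e K i) v = 0.
Hypothesis gen : forall W : set V, submodule rho W -> W v -> W = setT.
Hypothesis nilp : forall (i : 'I_n) (x : V), exists N, iter N (rho (km_f K i)) x = 0.

Let fn k := km_f K (node k).

Lemma fword_map w x : fword rho (map node w) x = actw rho fn w x.
Proof. by elim: w => //= k w ->. Qed.

(** This is [ballot_span] for [W = 0], p = l + 1, q = 0, with the degree of a word the sum of its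
    simple roots. *)
Lemma mu_space_span x : weight_space rho mu x ->
  lspan (fun y => exists2 w, w \in words & y = actw rho fn w v) x.
Proof.
move=> mx; have [w0 w0in] := ballot_word_exists.
pose gam k : weight K n := alpha (node k).
have st : gstable rho m (fun k => km_e K (node k)) fn
    (fun k => km_h (coroot K n (node k))) gam (fun _ x => x = 0).
  split=> [//|d a y z -> ->|d k y _ ->|d k y _ ->|d k y _ ->]; rewrite ?rep0r //.
  by rewrite scaler0 addr0.
have sg : singular_mod rho m (fun k => km_e K (node k))
    (fun k => km_h (coroot K n (node k))) gam (fun _ x => x = 0) (two_step l.+1 0) v 0.
  by split=> k km; [rewrite ev|rewrite Lv wt_Lam_node].
have cyc w : all (fun k => k < m)%N w ->
    cyclic_mod rho m fn gam (fun _ x => x = 0) v 0 (0 + wdeg gam w) (actw rho fn w v).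
  elim: w => [|k w IH] /=; first by rewrite /wdeg big_nil addr0; move=> _; apply: cycv.
  by case/andP=> km wm; rewrite wdeg_cons addrCA addrC; apply: cycF => //; apply: IH.
have free u w : all (fun k => k < m)%N u -> all (fun k => k < m)%N w ->
    wdeg gam u = wdeg gam w -> perm_eq u w.
  move=> um wm E; apply: node_map_inj => //; apply: (simple_root_free (K := K)); first by lia.
  by rewrite !big_map.
have stC := cyclic_mod_stable (chevalley_window hn ln K) st sg.
have Cx : cyclic_mod rho m fn gam (fun _ x => x = 0) v 0 (0 + wdeg gam w0) x.
  apply: lspan_sub (weight_space_span Lv ev gen mx); first exact: (gs0 stC).
    by move=> *; apply: (gsL stC).
  move=> y [u + ->]; rewrite (mu_word w0in) => /addrI /oppr_inj E.
  (* Independence of the simple roots keeps every word of this weight inside the window. *)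
  have pu : perm_eq u (map node w0) by apply: (simple_root_free (K := K)) => //; lia.
  have [w1 uE wm] : exists2 w1, u = map node w1 & all (fun k => k < m)%N w1.
    exists (map (node_inv l) u).
      by rewrite -map_comp -[LHS]map_id; apply: eq_map => i /=; rewrite node_invK.
    rewrite (perm_all _ (perm_map _ pu)) -map_comp; apply/allP => _ /mapP[k kin ->] /=.
    have km : (k < m)%N := allP (words_lt w0in) k kin.
    by rewrite nodeK //; lia.
  rewrite uE fword_map (_ : wdeg gam w0 = wdeg gam w1); first exact: cyc.
  by move: E; rewrite uE !big_map.
have mE : m = (2 * l.+1 + 0).-1 by lia.
have := ballot_span mE (chevalley_window hn ln K) st sg (fun k y _ => nilp (node k) y) free w0in Cx.
apply: lspan_sub; first exact: lspan0.
  by move=> *; apply: lspan_lin.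
by move=> y [->|yw]; [apply: lspan0|apply: lspan_gen].
Qed.

Let b (i : 'I_(size words)) : V := actw rho fn (nth [::] words i) v.

Lemma basis_weight i : weight_space rho mu (b i).
Proof.
have win : nth [::] words i \in words by apply: mem_nth.
by rewrite (mu_word win) /b -fword_map; apply: weight_space_fword.
Qed.

(** The relation and its counterpart in the model form a pair in [word_graph] with first component
    0, so the model relation holds too and [ballot_free] applies. *)
Lemma basis_free (c : 'I_(size words) -> K) :
  \sum_i c i *: b i = 0 -> forall i, c i = 0.
Proof.
move=> c0; have [w0 w0in] := ballot_word_exists.
pose vac : seq site -> K := ket K (extremal l.+1 0).
pose WG := word_graph rho m fn v vac.
have wg w : all (fun k => k < m)%N w -> WG (size w) (actw rho fn w v) (hopFs w vac).
  elim: w => [_|k w IH /= /andP[km wm]]; last by apply: WGF => //; apply: IH.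
  rewrite -[actw _ _ _ _]scale1r; apply: WGext (WG0 _ _ _ _ _ 1) _ => d _.
  by rewrite mul1r.
have wgi (i : 'I_(size words)) : WG (size w0) (b i) (hopFs (nth [::] words i) vac).
  have win : nth [::] words i \in words by apply: mem_nth.
  by rewrite -(perm_size (ballot_perm win w0in)); apply/wg/words_lt.
have wgs : WG (size w0) (\sum_i c i *: b i)
    (fun d => \sum_i c i * hopFs (nth [::] words i) vac d).
  elim: (index_enum _) => [|i r IH].
    rewrite big_nil; apply: word_graph_zero (wg _ (words_lt w0in)) _ => d _.
    by rewrite big_nil.
  rewrite big_cons; apply: WGext (WGL (c i) (wgi i) IH) _ => d _.
  by rewrite big_cons mul1r.
rewrite c0 in wgs.
(* Coefficients are transported from indices to words; as the words are distinct, [index] recovers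
   each index, and the default 0 is never met on [words]. *)
pose a w := if insub (index w words) is Some i then c i else 0.
have aE (i : 'I_(size words)) : a (nth [::] words i) = c i.
  by rewrite /a index_uniq ?ballot_uniq // valK.
suff az : forall w, w \in words -> a w = 0 by move=> i; rewrite -aE az ?mem_nth.
apply: ballot_free => d ds.
rewrite (big_nth [::]) big_mkord.
under eq_bigr => i _ do rewrite aE.
have chw := chevalley_window hn ln K.
apply: (word_graph_eq0 (lam := two_step l.+1 0) chw v0 _ _ _ _ wgs).
- by move=> k km; rewrite ev.
- by move=> k km; rewrite Lv wt_Lam_node.
- by move=> k z km zs; apply: hopE_extremal.
- by move=> k z km zs; apply: hopH_extremal; lia.
- by rewrite ds; lia.
Qed.

Lemma mu_multiplicity : multiplicity rho mu (size words).
Proof.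
exists b; split; [exact: basis_weight|exact: basis_free|].
move=> x /mu_space_span.
apply: (lspan_sub (P := fun y => exists c : 'I_(size words) -> K, y = \sum_i c i *: b i)).
- by exists (fun=> 0); rewrite big1 // => i _; rewrite scale0r.
- move=> a y z [cy ->] [cz ->]; exists (fun i => a * cy i + cz i).
  rewrite scaler_sumr -big_split; apply: eq_bigr => i _ /=.
  by rewrite scalerDl scalerA.
- move=> y [w win ->].
  have iw : (index w words < size words)%N by rewrite index_mem.
  exists (fun j => (j == Ordinal iw)%:R).
  rewrite (bigD1 (Ordinal iw)) //= eqxx scale1r big1 ?addr0.
    by rewrite /b /= nth_index.
  by move=> j /negPf ->; rewrite scale0r.
Qed.

(** A word of weight mu + delta, joined with all the nodes, would be a rearrangement of a ballot
    word; but ballot words miss [node m], just beyond the window. *)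
Lemma mu_maximal : maximal_weight rho mu.
Proof.
split.
  have s0 := ballot_words_neq0 l.+1 0.
  exists (b (Ordinal s0)); first exact: basis_weight.
  apply/eqP => b0; suff /eqP : (1 : K) = 0 by rewrite oner_eq0.
  apply: (basis_free (c := fun i => (i == Ordinal s0)%:R) _ (Ordinal s0)).
  rewrite (bigD1 (Ordinal s0)) // eqxx scale1r b0 [LHS]add0r big1 // => j /negPf ->.
  by rewrite scale0r.
case=> x mx; case/negP; apply/eqP.
apply: (lspan_sub (P := fun y => y = 0)) (weight_space_span Lv ev gen mx) => //.
  by move=> a u w -> ->; rewrite scaler0 addr0.
move=> y [u + _]; have [w0 w0in] := ballot_word_exists.
rewrite (mu_word w0in) -addrA => /addrI /(congr1 -%R).
rewrite opprK opprD opprK => E.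
have {}E : \sum_(i <- u ++ enum 'I_n) alpha i = \sum_(i <- map node w0) alpha i.
  rewrite big_cat big_enum E /= -[RHS]addr0 -addrA; congr (_ + _).
  by rewrite /null_root big_mkord addNr.
have /perm_mem /(_ (node m)) : perm_eq (u ++ enum 'I_n) (map node w0).
  by apply: (simple_root_free (K := K)) => //; lia.
rewrite mem_cat mem_enum orbT => /esym /mapP[k kin] /eqP.
have km : (k < m)%N := allP (words_lt w0in) k kin.
by rewrite node_eq; lia.
Qed.

End MaximalWeight.

Theorem mainTheorem5 (R : realType) (n l : nat) (hn : (2 <= n)%N)
    (hl : (1 <= l <= n %/ 2)%N)
    (V : lmodType R[i]) (rho : lieRep (affine_sl R[i] n) V)
    (hV : integrable_hw_module rho (2%:R *: fund_weight R[i] n 0)) :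
  let mu := 2%:R *: fund_weight R[i] n 0 - gamma_wt R[i] n l in
  [/\ dominant mu,
      maximal_weight rho mu
    & multiplicity rho mu #|[set w : 'S_l | avoids321 w]| ].
Proof.
move=> mu; subst mu; rewrite card_avoids321.
case: l hl => [|l] // hl; have hn0 : (0 < n)%N by lia.
have ln : (2 * l.+1 <= n)%N by move: hl (leq_trunc_div n 2); lia.
case: hV => [[v [v0 Lv ev gen]] [_ int]].
have nilp (i : 'I_n) (x : V) : exists N, iter N (rho (km_f R[i] i)) x = 0.
  by have [N [_ fN]] := int i x; exists N.
split.
- exact: mu_dominant hn0 ln.
- exact: (mu_maximal (K := R[i]) hn0 ln v0 Lv ev gen).
- exact: (mu_multiplicity (K := R[i]) hn0 ln v0 Lv ev gen nilp).
Qed.
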